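(* For an odd prime power $q$ and an integer $d\ge 3$, let $\mathcal{F}_d$ be the set of square-free monic polynomials of degree $d$ in $\mathbb{F}_q[X]$, and for $F\in\mathcal{F}_d$ let $S(F)=\sum_{x\in\mathbb{F}_q}\chi(F(x))$. If $d$ and $q$ both tend to infinity, then the moments of $S(F)/\sqrt q$ are asymptotically Gaussian with mean $0$ and variance $1$; that is, for every fixed integer $k\ge 1$, $$\frac{1}{|\mathcal{F}_d|}\sum_{F\in\mathcal{F}_d}\left(\frac{S(F)}{\sqrt q}\right)^k\longrightarrow \frac{1}{\sqrt{2\pi}}\int_{-\infty}^{\infty}t^k e^{-t^2/2}\,dt$$ as $q\to\infty$ and $d\to\infty$ jointly (in any manner). In particular, the limiting value distribution of $S(F)/\sqrt q$, for $F$ uniformly distributed in $\mathcal{F}_d$, is the standard Gaussian: the distributions converge weakly to the standard normal distribution as $q,d\to\infty$ jointly.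
   Context: $\mathbb{F}_q$ is the finite field with $q$ elements, $q$ odd. $\chi$ is the quadratic character of $\mathbb{F}_q^\times$, extended by $\chi(0)=0$: $\chi(a)=1$ if $a$ is a nonzero square, $\chi(a)=-1$ if $a$ is a nonsquare. A polynomial is square-free if it is not divisible by the square of any nonconstant polynomial. *)

(* Defs.v *)
From HB Require Import structures.
From mathcomp Require Import all_boot all_order all_algebra.
From mathcomp Require Import all_classical all_reals all_analysis.

Set Implicit Arguments.
Unset Strict Implicit.
Unset Printing Implicit Defensive.

Import Order.TTheory GRing.Theory Num.Theory.
Import numFieldNormedType.Exports.

Local Open Scope ring_scope.

Definition quad_char (F : finFieldType) (a : F) : int :=
  if a == 0 then 0 else if [exists b : F, b ^+ 2 == a] then 1 else -1.

Definition square_free (F : fieldType) (p : {poly F}) : Prop :=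
  forall g : {poly F}, (1 < size g)%N -> ~~ (g ^+ 2 %| p).

(* A polynomial of degree d has size d.+1, so the family can be carved out of *)
(* the finite type of polynomials of size at most d.+1.                       *)
Definition monic_sqfree (F : finFieldType) (d : nat) : {set {poly_(d.+1) F}} :=
  finset (fun p : {poly_(d.+1) F} =>
    [&& size (val p) == d.+1, val p \is monic & `[< square_free (val p) >]]).

Definition char_sum (F : finFieldType) (p : {poly F}) : int :=
  \sum_(x : F) quad_char p.[x].

Definition normalized_char_sum (R : realType) (F : finFieldType) (d : nat)
    (p : {poly_(d.+1) F}) : R :=
  (char_sum (val p))%:~R / Num.sqrt #|F|%:R.

Definition char_sum_moment (R : realType) (k : nat) (F : finFieldType)
    (d : nat) : R :=
  #|monic_sqfree F d|%:R^-1 *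
  \sum_(p in monic_sqfree F d) normalized_char_sum R p ^+ k.

Definition gaussian_moment (R : realType) (k : nat) : R :=
  (Num.sqrt (2 * pi))^-1 *
  (\int[lebesgue_measure]_(t in [set: R]) (t ^+ k * expR (- (t ^+ 2) / 2))).

(* The distribution of X(t) for t uniform in the finite set A (the zero       *)
(* measure if A is empty).                                                    *)
Section uniform_law.
Context (R : realType) (T : finType) (A : {set T}) (X : T -> R).

Definition uniform_law (B : set (measurableTypeR R)) : \bar R :=
  (#|finset (fun t => (t \in A) && (X t \in B))|%:R / #|A|%:R)%:E.

Let uniform_law0 : uniform_law set0 = 0%E.
Proof.
rewrite /uniform_law (_ : finset _ = finset.set0) ?cards0 ?mul0r//.
by apply/setP => t; rewrite !inE in_set0 andbF.
Qed.

Let uniform_law_ge0 B : (0 <= uniform_law B)%E.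
Proof. by rewrite lee_fin divr_ge0. Qed.

Let atom (i : nat) : {measure set (measurableTypeR R) -> \bar R} :=
  @dirac _ (measurableTypeR R) (nth 0 [seq X t | t in A] i) R.

Let uniform_lawE B : uniform_law B =
  mscale (#|A|%:R^-1)%:nng (msum atom #|A|) B.
Proof.
rewrite /uniform_law /mscale /= mulrC EFinM; congr (_ * _)%E.
transitivity (\sum_(y <- [seq X t | t in A])
    @dirac _ (measurableTypeR R) y R B : \bar R)%E; last first.
  by rewrite /msum (big_nth 0) big_mkord size_image.
rewrite big_image /= /dirac sumEFin; congr EFin.
rewrite -sum1_card natr_sum big_mkcond [RHS]big_mkcond /=.
apply: eq_bigr => t _; rewrite !inE indicE.
by case: (t \in A) => //=; case: (X t \in B).
Qed.

Let uniform_law_sigma_additive : semi_sigma_additive uniform_law.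
Proof.
move=> B mB tB mUB.
rewrite (_ : uniform_law = mscale (#|A|%:R^-1)%:nng (msum atom #|A|)).
  exact: measure_semi_sigma_additive.
exact/funext/uniform_lawE.
Qed.

HB.instance Definition _ := isMeasure.Build _ _ _ uniform_law
  uniform_law0 uniform_law_ge0 uniform_law_sigma_additive.

End uniform_law.

Definition char_sum_law (R : realType) (F : finFieldType) (d : nat) :
    {measure set (measurableTypeR R) -> \bar R} :=
  uniform_law (monic_sqfree F d) (@normalized_char_sum R F d).

(* Limit of a quantity attached to a finite field of odd order q and a degree *)
(* d >= 3, as q and d tend to infinity independently of each other.           *)
Definition joint_cvg (R : realType) (u : finFieldType -> nat -> R) (l : R) :
    Prop :=
  forall e : R, 0 < e -> exists N : nat, forall (F : finFieldType) (d : nat),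
    odd #|F| -> (3 <= d)%N -> (N <= #|F|)%N -> (N <= d)%N -> `|u F d - l| < e.

Definition joint_weak_cvg (R : realType)
    (mu : finFieldType -> nat -> {measure set (measurableTypeR R) -> \bar R})
    (nu : {measure set (measurableTypeR R) -> \bar R}) : Prop :=
  forall f : R -> R, continuous f -> [bounded f x | x in [set: R]] ->
    joint_cvg (fun F d => \int[mu F d]_(x in [set: R]) f x)
              (\int[nu]_(x in [set: R]) f x).

(* Main.v *)
(* Expand S(F)^k as a sum over words t = (x_1, ..., x_k) of the products       *)
(* h_t(F) = chi(F(x_1)) ... chi(F(x_k)).  Every monic F is uniquely D^2 G with  *)
(* D monic and G monic square-free, and h_t(D^2 G) = h_t(D^2) h_t(G) where      *)
(* h_t(D^2) is 0 or 1; hence the sums of h_t over square-free G of the various  *)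
(* degrees are governed by a recursion whose inhomogeneous term is the sum over *)
(* all monic F of degree n.  If some letter has odd multiplicity in t, that sum *)
(* vanishes for n >= k, and the recursion gives a square-root saving in q^d;    *)
(* otherwise h_t(F) = 1 unless F vanishes at a letter, which has probability at *)
(* most k/q.  So the k-th moment tends to the limit of q^(-k/2) times the       *)
(* number of words with only even multiplicities; this limit obeys the          *)
(* recursion m_(k+2) = (k+1) m_k of the Gaussian moments.                       *)
(* For weak convergence, call f a test function if the mean of f over the       *)
(* family tends to its Gaussian mean.  This class is linear, contains           *)
(* polynomials, and is closed under approximation with a test function of small *)
(* Gaussian mean as error.  Taylor's formula puts cos(bx + c) in it, product    *)
(* formulas then give the polynomials in sin(xi x), and Weierstrass's theorem   *)
(* (with xi small) all bounded continuous functions.                            *)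
Require Import Defs.
From mathcomp Require Import all_boot all_order all_algebra.
From mathcomp Require Import all_classical all_reals all_analysis.
From mathcomp Require Import measurable_realfun.
From mathcomp Require Import ring lra zify.

Set Implicit Arguments.
Unset Strict Implicit.
Unset Printing Implicit Defensive.

Import Order.TTheory GRing.Theory Num.Theory.
Import numFieldNormedType.Exports.

Local Open Scope ring_scope.

(** For a random square-free F of large degree, the values chi(F(x)) at a bounded number of points
    behave like independent random signs, up to a zero of probability about 1/q; so S(F) behaves
    like a sum of q independent signs, and its moments are those of the central limit theorem. The
    cancellation behind this is [sum_monics_word_char_odd]; [sum_word_char_odd] carries it over to
    square-free polynomials with an error of order (2 q)^(d/2), negligible against the roughly q^d
    polynomials. The words with even multiplicities supply the main term ([sum_word_char_even]), and
    asymptotically they are counted by pairings ([limit_odd_wordsE]). The error in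
    [dist_char_sum_moment] is uniform in d, which makes the limit joint. Weak convergence follows
    because the Gaussian moments grow slowly: the Taylor remainder of a cosine has Gaussian mean
    (b^2 / 2)^n / n!, which tends to 0 ([test_fun_cosine]), and the second moment controls what
    happens far from 0 ([bounded_continuous_sin_approx]). *)

(** * The quadratic character *)

Section QuadChar.
Variable F : finFieldType.
Local Notation chi := (@quad_char F).

Lemma quad_char0 : chi 0 = 0.
Proof. by rewrite /quad_char eqxx. Qed.

Lemma quad_char_sq (b : F) : chi (b ^+ 2) = (b != 0).
Proof.
rewrite /quad_char expf_eq0 /=; case: eqVneq => //= _.
by case: existsP => // -[]; exists b.
Qed.

Lemma quad_char_mul_sq (b a : F) : chi (b ^+ 2 * a) = chi (b ^+ 2) * chi a.
Proof.
rewrite quad_char_sq; have [->|b0] := eqVneq b 0.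
  by rewrite expr0n !mul0r quad_char0.
rewrite mul1r /quad_char mulf_eq0 expf_eq0 (negPf b0) /=.
case: (a == 0) => //; congr (if _ then _ else _).
apply/existsP/existsP => -[c /eqP ec].
  exists (b^-1 * c); apply/eqP; rewrite exprMn ec mulrA -exprMn mulVf //.
  by rewrite expr1n mul1r.
by exists (b * c); rewrite exprMn ec.
Qed.

Lemma quad_char_cube (a : F) : chi a ^+ 3 = chi a.
Proof. by rewrite /quad_char; case: ifP => // _; case: ifP. Qed.

Lemma sqr_quad_char (a : F) : chi a ^+ 2 = (a != 0).
Proof. by rewrite /quad_char; case: ifP => // _; case: ifP. Qed.

Lemma norm_quad_char (a : F) : `|chi a| <= 1.
Proof. by rewrite /quad_char; case: ifP => // _; case: ifP. Qed.

Lemma quad_charX_odd (a : F) n : odd n -> chi a ^+ n = chi a.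
Proof.
move=> on; rewrite -(odd_double_half n) on add1n exprS -mul2n exprM.
elim: n./2 => [|m IH]; first by rewrite mulr1.
by rewrite exprS mulrCA IH -exprSr quad_char_cube.
Qed.

Lemma quad_charX_even (a : F) n :
  (0 < n)%N -> ~~ odd n -> chi a ^+ n = (a != 0).
Proof.
case: n => // n _; rewrite /= negbK => on.
by rewrite exprS quad_charX_odd // -expr2 sqr_quad_char.
Qed.

Hypothesis oddq : odd #|F|.

(** Translation by 1 permutes the field, so summing all elements gives q times 1 = 0; with q odd and
    2 = 0 this would mean 1 = 0. *)
Lemma odd_card_field2_neq0 : (2%:R : F) != 0.
Proof.
apply/eqP => F2; have : \sum_(x : F) x + 1 *+ #|F| = \sum_(x : F) x.
  rewrite -sumr_const -big_split /= [RHS](reindex_inj (addIr (1 : F))).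
  by apply: eq_bigl.
rewrite -(odd_double_half #|F|) oddq add1n -mul2n mulrS mulrnA F2 mul0rn addr0.
by move=> /(canRL (addKr _)) /eqP; rewrite addNr oner_eq0.
Qed.

Lemma card_sqrt (a : F) : (#|[set b : F | b ^+ 2 == a]|%:R : int) = 1 + chi a.
Proof.
rewrite /quad_char; have [->|a0] := eqVneq a 0.
  rewrite (_ : [set b : F | _] = [set 0]) ?cards1 ?addr0 //.
  by apply/setP => b; rewrite !inE expf_eq0.
case: existsP => [[c /eqP ec]|nex]; last first.
  rewrite (_ : [set b : F | _] = finset.set0) ?cards0 //.
  by apply/setP => b; rewrite !inE; apply/negP => eb; apply: nex; exists b.
have c0 : c != 0 by apply: contra_neq a0 => c0; rewrite -ec c0 expr0n.
rewrite (_ : [set b : F | _] = [set c; - c]); last first.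
  by apply/setP => b; rewrite !inE -ec eqf_sqr.
rewrite cards2 -addr_eq0 -mulr2n -[c *+ 2]mulr_natl mulf_eq0 (negPf c0).
by rewrite (negPf odd_card_field2_neq0).
Qed.

(** By [card_sqrt], adding 1 to each term counts the elements b of the field according to their
    squares, which gives q in total. *)
Lemma sum_quad_char : \sum_a chi a = 0.
Proof.
apply: (addrI (\sum_(a : F) 1)); rewrite addr0 -big_split /=.
under eq_bigr do rewrite -card_sqrt.
rewrite -natr_sum sumr_const; congr (_%:R).
rewrite -sum1_card [RHS](partition_big (fun b : F => b ^+ 2) xpredT) //=.
apply: eq_bigr => a _; rewrite -sum1_card; apply: eq_bigl => b.
by rewrite inE.
Qed.

Lemma sum_quad_char_affine (a b : F) : b != 0 -> \sum_c chi (a + c * b) = 0.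
Proof.
move=> b0.
have inj : injective (fun c => a + c * b) by move=> c c' /addrI /(mulIf b0).
by rewrite -[RHS]sum_quad_char [RHS](reindex_inj inj).
Qed.
End QuadChar.

(** * Square-free parts *)

Lemma square_free_dvd (K : fieldType) (p r : {poly K}) :
  r %| p -> square_free p -> square_free r.
Proof.
move=> rp sp g sg; apply: contra (sp g sg) => gr; exact: dvdp_trans gr rp.
Qed.

Lemma square_free_size_le1 (K : fieldType) (a p : {poly K}) :
  square_free p -> a ^+ 2 %| p -> (size a <= 1)%N.
Proof. by move=> sp ap; rewrite leqNgt; apply/negP => /sp; rewrite ap. Qed.

(** After division by the gcd, a^2 G = b^2 G' with a and b coprime, so a^2 divides G' and b^2
    divides G. Square-freeness makes a and b constant, so D and D' are both associates of the
    gcd. *)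
Lemma square_part_uniq (K : fieldType) (D D' G G' : {poly K}) :
  D \is monic -> D' \is monic -> square_free G -> square_free G' ->
  D ^+ 2 * G = D' ^+ 2 * G' -> D = D'.
Proof.
move=> mD mD' sG sG' eDG.
have D0 := monic_neq0 mD; have D'0 := monic_neq0 mD'.
set g := gcdp D D'.
have g0 : g != 0 by rewrite gcdp_eq0 negb_and D0.
set a := D %/ g; set b := D' %/ g.
have eD : a * g = D by rewrite /a divpK // dvdp_gcdl.
have eD' : b * g = D' by rewrite /b divpK // dvdp_gcdr.
have cab : coprimep a b by rewrite coprimep_div_gcd ?D0.
have a0 : a != 0 by apply: contraNneq D0 => a0; rewrite -eD a0 mul0r.
have b0 : b != 0 by apply: contraNneq D'0 => b0; rewrite -eD' b0 mul0r.
have {eDG} eab : a ^+ 2 * G = b ^+ 2 * G'.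
  apply: (mulfI (expf_neq0 2 g0)); rewrite mulrA [RHS]mulrA -!exprMn.
  by rewrite ![g * _]mulrC eD eD'.
have sz (x : {poly K}) : x != 0 -> (size x <= 1)%N -> x * g %= g.
  move=> x0 x1; have /size_poly1P [c c0 ->] : size x == 1%N.
    by rewrite eqn_leq x1 lt0n size_poly_eq0.
  by rewrite mul_polyC eqp_scale.
have sa : (size a <= 1)%N.
  apply: (square_free_size_le1 sG').
  have := dvdp_mulr G (dvdpp (a ^+ 2)).
  by rewrite eab Gauss_dvdpr // coprimep_expl ?coprimep_expr.
have sb : (size b <= 1)%N.
  apply: (square_free_size_le1 sG).
  have := dvdp_mulr G' (dvdpp (b ^+ 2)).
  by rewrite -eab Gauss_dvdpr // coprimep_expl ?coprimep_expr // coprimep_sym.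
apply/eqP; rewrite -eqp_monic // -eD -eD'.
by apply: eqp_trans (sz a a0 sa) _; rewrite eqp_sym; exact: sz.
Qed.

Lemma square_part_exists (K : fieldType) (p : {poly K}) : p \is monic ->
  exists D G : {poly K},
    [/\ D \is monic, G \is monic, square_free G & p = D ^+ 2 * G].
Proof.
have [n] := ubnP (size p); elim: n p => // n IH p; rewrite ltnS => sp mp.
have [sqp|] := pselect (square_free p).
  by exists 1, p; rewrite monic1 expr1n mul1r.
move=> /existsNP[g] /not_implyP[sg /negP]; rewrite negbK => gp.
have g0 : g != 0 by rewrite -size_poly_gt0 (ltn_trans _ sg).
pose u := (lead_coef g)^-1 *: g.
have lg0 : lead_coef g != 0 by rewrite lead_coef_eq0.
have mu : u \is monic by rewrite monicE lead_coefZ mulVf.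
have up : u ^+ 2 %| p by rewrite exprZn dvdpZl // expf_neq0 // invr_neq0.
have su : (1 < size u)%N by rewrite size_scale ?invr_neq0.
clearbody u.
have ep : p %/ u ^+ 2 * u ^+ 2 = p by rewrite divpK.
have mr : p %/ u ^+ 2 \is monic.
  by move: mp; rewrite -{1}ep monicMr // monic_exp.
have [||D [G [mD mG sG eG]]] := IH (p %/ u ^+ 2) => //.
  apply: leq_trans sp; rewrite -{2}ep size_Mmonic ?monic_exp ?monic_neq0 //.
  have su2 : (2 < size (u ^+ 2)%R)%N.
    by rewrite expr2 size_Mmonic ?monic_neq0 //; lia.
  have : (0 < size (p %/ u ^+ 2)%R)%N by rewrite size_poly_gt0 monic_neq0.
  move: su2; move: (size (u ^+ 2)) (size _) => a b; lia.
exists (D * u), G; split=> //; first by rewrite monicMl.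
by rewrite -ep eG exprMn mulrAC.
Qed.

(** * Monic and square-free monic polynomials by degree *)

Section MonicPolys.
Variable F : finFieldType.

(** Encoding by the lower-order part makes the count q^n and the invariance under adding polynomials
    of size at most n immediate. *)
Definition monics n : seq {poly F} := [seq 'X^n + val p | p : {poly_n F}].

Definition monic_sqfrees n : seq {poly F} :=
  [seq p <- monics n | `[< square_free p >]].

Lemma mem_monics n (p : {poly F}) :
  (p \in monics n) = (p \is monic) && (size p == n.+1).
Proof.
apply/mapP/andP => [[r _ ->]|[mp /eqP sp]].
  have sr := size_npoly r.
  have lt : (size (val r) < size ('X^n : {poly F}))%N by rewrite size_polyXn.
  by rewrite monicE lead_coefDl // size_polyDl // lead_coefXn size_polyXn.
have sr : (size (p - 'X^n)%R <= n)%N.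
  apply/leq_sizeP => j; rewrite leq_eqVlt => /predU1P[<-|nj].
    rewrite coefB coefXn eqxx.
    by move: mp; rewrite monicE /lead_coef sp => /eqP ->; rewrite subrr.
  by rewrite coefB coefXn gtn_eqF // nth_default ?sp ?subrr.
exists (npolyp n (p - 'X^n)); first by rewrite mem_enum.
by rewrite /= npolypK // addrC subrK.
Qed.

Lemma monics_uniq n : uniq (monics n).
Proof. by rewrite map_inj_uniq ?enum_uniq // => p r /addrI /val_inj. Qed.

Lemma size_monics n : size (monics n) = (#|F| ^ n)%N.
Proof.
rewrite size_map -cardE -[n in RHS]mul1n -card_mx.
apply: (bij_eq_card (f := @npoly_rV F n)).
by exists (@rVnpoly F n); [exact: npoly_rV_K | exact: rVnpolyK].
Qed.

Lemma mem_monic_sqfrees n (p : {poly F}) : (p \in monic_sqfrees n) =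
  [&& p \is monic, size p == n.+1 & `[< square_free p >]].
Proof. by rewrite mem_filter mem_monics andbC andbA. Qed.

Lemma monic_sqfrees_uniq n : uniq (monic_sqfrees n).
Proof. exact: filter_uniq (monics_uniq n). Qed.

Lemma sum_monic_sqfree (V : nmodType) d (h : {poly F} -> V) :
  \sum_(p in monic_sqfree F d) h (val p) = \sum_(p <- monic_sqfrees d) h p.
Proof.
rewrite -big_enum /= -(big_map val xpredT h); apply: perm_big.
apply: uniq_perm; rewrite ?monic_sqfrees_uniq //.
  by rewrite map_inj_uniq ?enum_uniq //; exact: val_inj.
move=> p; rewrite mem_monic_sqfrees.
apply/mapP/and3P => [[r]|[mp sp fp]].
  by rewrite mem_enum inE => /and3P[? ? ?] ->.
exists (npolyp d.+1 p); last by rewrite /= npolypK ?(eqP sp).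
by rewrite mem_enum inE /= npolypK ?(eqP sp) // eqxx mp.
Qed.

Lemma card_monic_sqfree d : #|monic_sqfree F d| = size (monic_sqfrees d).
Proof.
have := sum_monic_sqfree d (fun=> 1%N).
rewrite sum1_size => <-; by rewrite sum1_card.
Qed.

(** Every p is D^2 G in exactly one way; the terms are sorted by the degree m of D. Both recursions
    over the degree, for cardinalities and for character sums, come from this identity. *)
Lemma sum_monics_square_part (V : nmodType) n (h : {poly F} -> V) :
  \sum_(p <- monics n) h p =
  \sum_(m < n./2.+1) \sum_(D <- monics m)
    \sum_(G <- monic_sqfrees (n - m.*2)) h (D ^+ 2 * G).
Proof.
pose Ds := [seq D | m <- iota 0 n./2.+1, D <- monics m].
pose Gs (D : {poly F}) := monic_sqfrees (n - (size D).-1.*2).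
have memDs D : (D \in Ds) = (D \is monic) && (size D <= n./2.+1)%N.
  apply/allpairsPdep/andP => [[m [D' [mm mD ->]]]|[mD sD]].
    move: mm mD; rewrite mem_iota mem_monics add0n.
    move=> /andP[_ mn] /andP[-> /eqP ->].
    by split.
  have D0 : (0 < size D)%N by rewrite size_poly_gt0 monic_neq0.
  exists (size D).-1, D; rewrite mem_iota mem_monics add0n /=.
  by rewrite prednK // mD eqxx sD.
have uDs : uniq Ds.
  apply: allpairs_uniq_dep; rewrite ?iota_uniq //.
    by move=> m _; exact: monics_uniq.
  move=> p r /allpairsPdep[m [D [_ + ->]]] /allpairsPdep[m' [D' [_ + ->]]] /=.
  rewrite !mem_monics => /andP[_ /eqP sD] /andP[_ /eqP sD'] e.
  by move: sD; rewrite e sD' => -[->].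
have perm : perm_eq (monics n) [seq D ^+ 2 * G | D <- Ds, G <- Gs D].
  apply: uniq_perm; first exact: monics_uniq.
    apply: allpairs_uniq_dep => // [D _|]; first exact: monic_sqfrees_uniq.
    move=> p r /allpairsPdep[x [y [+ + ->]]] /allpairsPdep[x' [y' [+ + ->]]] /=.
    rewrite !memDs !mem_monic_sqfrees => /andP[mx _] /and3P[_ _ /asboolP sy].
    move=> /andP[mx' _] /and3P[_ _ /asboolP sy'] e.
    have exx := square_part_uniq mx mx' sy sy' e; rewrite -exx in e *.
    by rewrite (mulfI (expf_neq0 2 (monic_neq0 mx)) e).
  move=> p; rewrite mem_monics; apply/andP/allpairsPdep => [[mp /eqP sp]|].
    have [D [G [mD mG sG ep]]] := square_part_exists mp.
    have D0 : (0 < size D)%N by rewrite size_poly_gt0 monic_neq0.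
    have G0 : (0 < size G)%N by rewrite size_poly_gt0 monic_neq0.
    have : n.+1 = ((size D).-1.*2 + size G)%N.
      rewrite -sp ep size_Mmonic ?monic_neq0 ?monic_exp // expr2.
      rewrite size_Mmonic ?monic_neq0 //.
      by move: (size D) (size G) D0 G0 => a b; lia.
    move=> e; exists D, G; rewrite memDs mem_monic_sqfrees mD mG asboolT //=.
    move: (size D) (size G) D0 G0 e => a b a0 b0 e; split=> //; first lia.
    by rewrite andbT; apply/eqP; lia.
  move=> [D [G []]]; rewrite memDs mem_monic_sqfrees.
  move=> /andP[mD sD] /and3P[mG /eqP sG _] ->.
  have D0 : (0 < size D)%N by rewrite size_poly_gt0 monic_neq0.
  rewrite monicMl ?monic_exp //; split=> //; apply/eqP.
  rewrite size_Mmonic ?monic_neq0 ?monic_exp // expr2.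
  rewrite size_Mmonic ?monic_neq0 // sG.
  by move: (size D) D0 sD => a; lia.
rewrite (perm_big _ perm) !big_allpairs_dep.
rewrite -[iota 0 _]/(index_iota 0 n./2.+1) big_mkord; apply: eq_bigr => m _.
rewrite big_seq_cond [RHS]big_seq_cond; apply: eq_bigr => D.
by rewrite mem_monics /Gs => /andP[/andP[_ /eqP ->] _].
Qed.
End MonicPolys.

(** * Character sums over words *)

Lemma intr_natr (R : pzRingType) n : (n%:R : int)%:~R = n%:R :> R.
Proof. by rewrite natz -pmulrn. Qed.

Section Words.
Variable T : finType.

Fixpoint words k : seq (seq T) :=
  if k is k'.+1 then [seq x :: t | x <- enum T, t <- words k'] else [:: [::]].

(** Only these letters matter for cancellation: a letter of positive even multiplicity contributes 1
    unless the polynomial vanishes there. *)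
Definition odd_letters (t : seq T) : {set T} :=
  finset (fun x => odd (count_mem x t)).

Lemma sum_words_cons (V : nmodType) k (h : seq T -> V) :
  \sum_(t <- words k.+1) h t = \sum_x \sum_(t <- words k) h (x :: t).
Proof. by rewrite /= big_allpairs_dep big_enum. Qed.

Lemma size_words_mem k t : t \in words k -> size t = k.
Proof.
elim: k t => [|k IH] t /=; first by rewrite inE => /eqP ->.
by move=> /allpairsP[[x s] [_ /= /IH <- ->]].
Qed.

Lemma size_words k : size (words k) = (#|T| ^ k)%N.
Proof. by elim: k => //= k IH; rewrite size_allpairs IH -cardE expnS. Qed.

Lemma expr_sum_words (A : comPzSemiRingType) (f : T -> A) k :
  (\sum_x f x) ^+ k = \sum_(t <- words k) \prod_(x <- t) f x.
Proof.
elim: k => [|k IH]; first by rewrite big_seq1 big_nil.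
rewrite sum_words_cons exprS IH mulr_suml; apply: eq_bigr => x _.
by rewrite mulr_sumr; apply: eq_bigr => t _; rewrite big_cons.
Qed.
End Words.

Section WordChar.
Variable F : finFieldType.
Local Notation q := #|F|.
Implicit Types (t : seq F) (p D G : {poly F}).

Definition word_char t p : int := \prod_(x <- t) quad_char p.[x].

Lemma char_sumX p k :
  char_sum p ^+ k = \sum_(t <- words F k) word_char t p.
Proof. exact: expr_sum_words. Qed.

Lemma word_char_mul_sq t D G :
  word_char t (D ^+ 2 * G) = word_char t (D ^+ 2) * word_char t G.
Proof.
rewrite -big_split; apply: eq_bigr => x _.
by rewrite hornerM horner_exp quad_char_mul_sq.
Qed.

Lemma norm_word_char t p : `|word_char t p| <= 1.
Proof.
rewrite /word_char; elim: t => [|x t IH]; first by rewrite big_nil normr1.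
by rewrite big_cons normrM mulr_ile1 ?normr_ge0 ?norm_quad_char.
Qed.

Lemma word_char_even t p : odd_letters t = finset.set0 ->
  word_char t p = all (fun x => p.[x] != 0) t.
Proof.
move=> even_t; rewrite /word_char -prodr_undup_exp_count.
have [/allP nz|/allPn[x xt]] := boolP (all _ t); last first.
  rewrite negbK => /eqP px; rewrite (bigD1_seq x) ?undup_uniq ?mem_undup //=.
  by rewrite px quad_char0 expr0n eqn0Ngt -has_count has_pred1 xt mul0r.
rewrite big1_seq // => x /andP[_]; rewrite mem_undup => xt.
rewrite quad_charX_even ?nz -?has_count ?has_pred1 //.
by move/setP/(_ x): even_t; rewrite !inE => ->.
Qed.

(** For such a word the character is 0 or 1, and it is 0 only if p vanishes at some letter: a union
    bound. *)
Lemma even_word_char_close t p : odd_letters t = finset.set0 ->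
  0 <= 1 - word_char t p <= \sum_(x <- t) ((p.[x] == 0) : nat)%:R.
Proof.
move=> /word_char_even ->.
have ge0 (s : seq F) : (0 : int) <= \sum_(x <- s) ((p.[x] == 0) : nat)%:R.
  by apply: sumr_ge0 => x _; rewrite ler0n.
case: allP => [_|/allP/allPn[x xt]]; first by rewrite subrr lexx ge0.
rewrite negbK => px; rewrite subr0 ler01 /=.
have [s1 [s2 ->]] : exists s1 s2, t = s1 ++ x :: s2.
  by case/splitPr: xt => s1 s2; exists s1, s2.
by rewrite big_cat big_cons /= px addrCA lerDl addr_ge0.
Qed.

(** A polynomial with root x is G (X - x), and G inherits square-freeness, so multiplication by X -
    x from degree n reaches all of them. *)
Lemma count_root_monic_sqfrees n (x : F) :
  (count (fun p => root p x) (monic_sqfrees F n.+1)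
     <= size (monic_sqfrees F n))%N.
Proof.
rewrite -size_filter -(size_map (fun G => G * ('X - x%:P)) (monic_sqfrees F n)).
apply: uniq_leq_size; first exact/filter_uniq/monic_sqfrees_uniq.
move=> p; rewrite mem_filter mem_monic_sqfrees.
move=> /and4P[/factor_theorem[G eG] mp sp /asboolP fp].
apply/mapP; exists G => //; rewrite mem_monic_sqfrees.
have mG : G \is monic by move: mp; rewrite eG monicMr ?monicXsubC.
rewrite mG /=; apply/andP; split; last first.
  by apply/asboolP; apply: (square_free_dvd _ fp); rewrite eG dvdp_mulr.
move: sp; rewrite eG size_Mmonic ?monicXsubC ?monic_neq0 // size_XsubC.
by rewrite addn2 /= eqSS.
Qed.

Lemma sum_root_monic_sqfrees n t :
  \sum_(p <- monic_sqfrees F n.+1) \sum_(x <- t) ((p.[x] == 0) : nat)%:R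
    <= (size t * size (monic_sqfrees F n))%:R :> int.
Proof.
rewrite exchange_big /=; under eq_bigr do rewrite -natr_sum.
rewrite -natr_sum ler_nat -sum1_size big_distrl /= leq_sum // => x _.
rewrite mul1n -big_mkcond /= sum1_count; exact: count_root_monic_sqfrees.
Qed.

Lemma sum_word_char_even n t : odd_letters t = finset.set0 ->
  `|\sum_(p <- monic_sqfrees F n.+1) word_char t p
      - (size (monic_sqfrees F n.+1))%:R|
    <= (size t * size (monic_sqfrees F n))%:R.
Proof.
move=> even_t; rewrite distrC -sum1_size natr_sum -sumrB.
rewrite ger0_norm; last first.
  by apply: sumr_ge0 => p _; have /andP[] := even_word_char_close p even_t.
apply: le_trans (sum_root_monic_sqfrees n t); apply: ler_sum => p _.
by have /andP[] := even_word_char_close p even_t.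
Qed.

(* Translating by multiples of a polynomial P that vanishes at all letters but   *)
(* x0 makes the value at x0 run through F and leaves the other values unchanged. *)
Lemma sum_monics_word_char_odd n t : odd q -> (size t <= n)%N ->
  odd_letters t != finset.set0 -> \sum_(p <- monics F n) word_char t p = 0.
Proof.
move=> oq tn /finset.set0Pn[x0]; rewrite inE => ox0.
pose P := \prod_(x <- t | x != x0) ('X - x%:P).
(* Since x0 occurs in t, P has fewer than [size t] factors; hence adding multiples of P preserves
   monic polynomials of degree n. *)
have sP : (size P <= n)%N.
  rewrite /P -big_filter size_prod_XsubC size_filter.
  have : (0 < count_mem x0 t)%N by case: (count_mem x0 t) ox0.
  have -> : count (fun x => x != x0) t = count (predC (pred1 x0)) t.
    exact: eq_count.
  move: tn; rewrite -(count_predC (pred1 x0) t).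
  by move: (count _ t) (count _ t) => a b; lia.
have Px0 : P.[x0] != 0.
  rewrite horner_prod prodf_seq_neq0; apply/allP => x _; apply/implyP => xx0.
  by rewrite hornerXsubC subr_eq0 eq_sym.
pose u p : int := \prod_(x <- t | x != x0) quad_char p.[x].
have wE p : word_char t p = quad_char p.[x0] * u p.
  rewrite /word_char (bigID (pred1 x0)) /=; congr (_ * _).
  rewrite (eq_bigr (fun=> quad_char p.[x0])) => [|x /eqP -> //].
  by rewrite big_const_seq iter_mulr_1 quad_charX_odd.
have uP p c : u (p + c *: P) = u p.
  rewrite /u big_seq_cond [RHS]big_seq_cond; apply: eq_bigr => x /andP[xt xx0].
  rewrite hornerD hornerZ (_ : P.[x] = 0) ?mulr0 ?addr0 //.
  apply/eqP; rewrite horner_prod prodf_seq_eq0; apply/hasP; exists x => //.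
  by rewrite xx0 hornerXsubC subrr eqxx.
have shift c : \sum_(p <- monics F n) word_char t p
    = \sum_(p <- monics F n) word_char t (p + c *: P).
  rewrite !big_image /= (reindex_inj (addIr (npolyp n (c *: P)))) /=.
  apply: eq_bigr => r _; congr (word_char t _).
  by rewrite -addrA npolypK // (leq_trans (size_scale_leq _ _)).
(* The sum does not depend on the shift c, so it is averaged over c: for fixed p the value at x0
   gives a full affine character sum, which vanishes. *)
have : \sum_(c : F) \sum_(p <- monics F n) word_char t p = 0.
  under eq_bigr => c _ do rewrite (shift c).
  rewrite exchange_big big1_seq //= => p _.
  under eq_bigr => c _ do rewrite wE uP hornerD hornerZ.
  by rewrite -mulr_suml sum_quad_char_affine // mul0r.
rewrite sumr_const => /eqP; rewrite mulrn_eq0.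
by case/predU1P=> [q0|/eqP//]; rewrite q0 in oq.
Qed.

Lemma monics0 : monics F 0 = [:: 1].
Proof.
have := size_monics F 0; case e : (monics F 0) => [|p [|]] //= _.
have : 1 \in monics F 0 by rewrite mem_monics monic1 size_poly1.
by rewrite e inE => /eqP ->.
Qed.

Lemma size_monics_square_part n : (#|F| ^ n =
  \sum_(m < n./2.+1) #|F| ^ m * size (monic_sqfrees F (n - m.*2)))%N.
Proof.
rewrite -[LHS]size_monics -sum1_size.
transitivity (\sum_(m < n./2.+1) \sum_(D <- monics F m)
                \sum_(G <- monic_sqfrees F (n - m.*2)) 1)%N.
  exact: (sum_monics_square_part n (fun=> 1%N)).
apply: eq_bigr => m _; under eq_bigr do rewrite sum1_size.
by rewrite big_const_seq count_predT iter_addn_0 mulnC size_monics.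
Qed.

(** In the expansion of q^(n + 2) by square parts, the terms with m >= 1 are q times the expansion
    of q^n; the term m = 0 is the number sought. *)
Lemma size_monic_sqfrees n :
  (size (monic_sqfrees F n.+2) + #|F| ^ n.+1 = #|F| ^ n.+2)%N.
Proof.
rewrite [RHS]size_monics_square_part /= big_ord_recl /= subn0 mul1n.
congr (_ + _)%N; rewrite expnS [in LHS]size_monics_square_part big_distrr.
by apply: eq_bigr => m _; rewrite /= /bump /= add1n expnS -mulnA doubleS !subSS.
Qed.

(* The base r = sqrt (2 q) satisfies q^m r^(n - 2m) = r^n / 2^m, so that the     *)
(* recursion over the degree closes up.                                          *)
Lemma sum_word_char_odd (R : rcfType) n t : odd q -> 
  odd_letters t != finset.set0 ->
  (`|\sum_(p <- monic_sqfrees F n) word_char t p|)%:~R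
    <= q%:R ^+ size t * Num.sqrt (2 * q%:R) ^+ n :> R.
Proof.
move=> oq odd_t; set r := Num.sqrt _.
have q1 : (1 : R) <= q%:R by rewrite ler1n; case: (q) oq.
have r2 : r ^+ 2 = 2 * q%:R by rewrite sqr_sqrtr // mulr_ge0.
have r1 : 1 <= r.
  apply: (@le_trans _ _ (Num.sqrt 1)); first by rewrite sqrtr1.
  by rewrite ler_wsqrtr //; lra.
have r0 : 0 < r by lra.
elim/ltn_ind: n => n IH.
(* In degree below [size t] the full sum need not vanish, but the trivial bound q^n suffices. *)
have [nt|tn] := ltnP n (size t).
  apply: (@le_trans _ _ (q%:R ^+ n)).
    apply: (@le_trans _ _ ((size (monic_sqfrees F n))%:R)).
      rewrite -intr_natr ler_int; apply: le_trans (ler_norm_sum _ _ _) _.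
      rewrite -sum1_size natr_sum; apply: ler_sum => p _.
      exact: norm_word_char.
    by rewrite -natrX ler_nat -size_monics size_filter count_size.
  rewrite -[leLHS]mulr1 ler_pM ?exprn_ge0 ?exprn_ege1 //.
  by apply: ler_weXn2l => //; exact: ltnW.
(* The term D = 1 is the sum over square-free polynomials; as the full sum vanishes, it is minus the
   terms with m >= 1, which the induction bounds by a geometric series of ratio 1/2. *)
have := sum_monics_word_char_odd oq tn odd_t.
rewrite sum_monics_square_part big_ord_recl /= monics0 big_seq1 subn0.
under eq_bigr => G _ do rewrite expr1n mul1r.
move/eqP; rewrite addr_eq0 => /eqP ->; rewrite normrN.
apply: (@le_trans _ _ (\sum_(i < n./2) q%:R ^+ size t * r ^+ n / 2 ^+ i.+1)).
  apply: (@le_trans _ _ (\sum_(i < n./2) (`|\sum_(D <- monics F (lift ord0 i))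
      \sum_(G <- monic_sqfrees F (n - (lift ord0 i).*2))
         word_char t (D ^+ 2 * G)|)%:~R)).
    by rewrite -rmorph_sum /= ler_int ler_norm_sum.
  apply: ler_sum => i _; rewrite lift0.
  set B : int := \sum_(G <- monic_sqfrees F (n - i.+1.*2)) word_char t G.
  have i2 : (i.+1.*2 <= n)%N.
    by have := ltn_ord i; have := odd_double_half n; lia.
  apply: (@le_trans _ _ ((q ^ i.+1)%N%:R * (`|B|)%:~R)).
    rewrite -intr_natr -intrM ler_int; apply: le_trans (ler_norm_sum _ _ _) _.
    rewrite -size_monics -sum1_size natr_sum mulr_suml; apply: ler_sum => D _.
    under eq_bigr => G _ do rewrite word_char_mul_sq.
    by rewrite -mulr_sumr normrM ler_wpM2r // norm_word_char.
  have IHi := IH (n - i.+1.*2)%N.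
  apply: (@le_trans _ _ ((q ^ i.+1)%N%:R *
                         (q%:R ^+ size t * r ^+ (n - i.+1.*2)))).
    by rewrite ler_wpM2l ?ler0n // IHi //; lia.
  have -> : r ^+ n = 2 ^+ i.+1 * q%:R ^+ i.+1 * r ^+ (n - i.+1.*2).
    by rewrite -{1}(subnKC i2) exprD -mul2n exprM r2 exprMn.
  have : (2 : R) ^+ i.+1 != 0 by rewrite expf_neq0 // pnatr_eq0.
  rewrite natrX; move: (2 ^+ i.+1 : R) (q%:R ^+ i.+1 : R) (q%:R ^+ size t : R).
  move: (r ^+ (n - i.+1.*2)).
  by move=> a b c e a0; rewrite le_eqVlt; apply/orP; left; apply/eqP; field.
rewrite -mulr_sumr ler_piMr ?mulr_ge0 ?exprn_ge0 //; first lra.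
have -> : \sum_(i < n./2) (2 ^+ i.+1)^-1 = 1 - (2 ^+ n./2)^-1 :> R.
  elim: n./2 => [|m IHm]; first by rewrite big_ord0 expr0 invr1 subrr.
  rewrite big_ord_recr /= IHm !exprS invfM; lra.
by rewrite lerBlDr lerDl invr_ge0 exprn_ge0.
Qed.
End WordChar.
Local Open Scope classical_set_scope.

(** * Counting words *)

(* The number of words of length k over q letters whose set of letters of odd   *)
(* multiplicity is a given set of size s; prepending a letter toggles its       *)
(* membership in that set.                                                      *)
Fixpoint nb_odd_words q k s : nat :=
  if k is k'.+1 then
    s * nb_odd_words q k' s.-1 + (q - s) * nb_odd_words q k' s.+1
  else (s == 0)%N.

Lemma odd_letters_cons (T : finType) (x : T) t :
  odd_letters (x :: t) =
  (if x \in odd_letters t then finset.setD (odd_letters t) [set x]%SET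
   else finset.setU [set x]%SET (odd_letters t)).
Proof.
apply/finset.setP => y; rewrite !inE /= oddD oddb eq_sym.
by case: ifP => ox; rewrite !inE; case: eqVneq => [->|_] //=; rewrite ox.
Qed.

Lemma count_words_odd_letters (T : finType) k (S : {set T}) :
  count (fun t => odd_letters t == S) (words T k) = nb_odd_words #|T| k #|S|.
Proof.
elim: k S => [|k IH] S.
  have e0 : odd_letters [::] = finset.set0 :> {set T}.
    by apply/finset.setP => y; rewrite !inE.
  by rewrite -[LHS]/((odd_letters [::] == S) + 0)%N addn0 e0 eq_sym -cards_eq0.
rewrite -sum1_count big_mkcond sum_words_cons (bigID (mem S)) /=.
congr (_ + _)%N.
  rewrite (eq_bigr (fun=> nb_odd_words #|T| k #|S|.-1)) => [|x xS].
    by rewrite sum_nat_const.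
  rewrite -big_mkcond /= sum1_count (cardsD1 x S) xS add1n -IH.
  apply: eq_count => t; rewrite odd_letters_cons.
  apply/eqP/eqP => [|->]; last by rewrite !inE eqxx finset.setD1K.
  case: ifP => [xt eS|/negbT xt <-]; last by rewrite finset.setU1K.
  by rewrite -eS !inE eqxx in xS.
rewrite (eq_bigr (fun=> nb_odd_words #|T| k #|S|.+1)) => [|x xS].
  rewrite sum_nat_const; congr (_ * _)%N.
  by rewrite -(cardC (mem S)) addKn; apply: eq_card => x; rewrite !inE.
rewrite -big_mkcond /= sum1_count.
have -> : #|S|.+1 = #|x |: S|%SET by rewrite cardsU1 xS.
rewrite -IH; apply: eq_count => t; rewrite odd_letters_cons.
apply/eqP/eqP => [|->]; last by rewrite !inE eqxx finset.setU1K.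
case: ifP => [xt <-|/negbT xt eS]; first by rewrite finset.setD1K.
by rewrite -eS !inE eqxx in xS.
Qed.

(** The double factorial (k - 1)!! for even k, and 0 for odd k. *)
Fixpoint nat_gauss_moment k : nat :=
  if k is k'.+2 then k'.+1 * nat_gauss_moment k' else (k == 0)%N.

(* Limit of q^((s - k) / 2) nb_odd_words q k s.                                  *)
Fixpoint limit_odd_words k s : nat :=
  if k is k'.+1 then s * limit_odd_words k' s.-1 + limit_odd_words k' s.+1
  else (s == 0)%N.

Lemma nat_gauss_momentSS k :
  nat_gauss_moment k.+2 = (k.+1 * nat_gauss_moment k)%N.
Proof. by []. Qed.

(** Asymptotically each of the s prescribed letters occurs once, in one of k^_s placements, and the
    other k - s positions are matched in pairs. *)
Lemma limit_odd_wordsE k s :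
  limit_odd_words k s = (k ^_ s * nat_gauss_moment (k - s))%N.
Proof.
elim: k s => [|k IH] [|s] //=.
  rewrite mul0n add0n IH ffactn0 ffactn1 mul1n.
  by case: k {IH} => // k; rewrite subSS subn0.
rewrite !IH subSS ffactSS.
have [ks|sk] := ltnP k s; first by rewrite !ffact_small ?muln0 //; lia.
rewrite -(subnKC sk) addKn; move: (k - s)%N => j.
have -> : ((s + j) ^_ s.+2 = (s + j) ^_ s * j * j.-1)%N.
  by rewrite !ffactnSr addKn; congr (_ * _)%N; lia.
case: j => [|[|j]].
- by rewrite !muln0 addn0 addn0 mulnA.
- by rewrite !muln0.
have -> : (s + j.+2 - s.+2 = j)%N by lia.
rewrite nat_gauss_momentSS succnK.
move: (_ ^_ s)%N (nat_gauss_moment j) => a b; nia.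
Qed.

Section Limit.
Variable R : realType.

Definition normalized_odd_words k s (q : nat) : R :=
  (nb_odd_words q k s)%:R * Num.sqrt q%:R ^+ s / Num.sqrt q%:R ^+ k.

(** Scaling by q^((s - k) / 2) turns the growing coefficient q - s into 1 - s / q, so the recursion
    has a limit. *)
Lemma normalized_odd_wordsS k s q : (0 < q)%N -> (s <= q)%N ->
  normalized_odd_words k.+1 s q =
  s%:R * normalized_odd_words k s.-1 q
  + (1 - s%:R / q%:R) * normalized_odd_words k s.+1 q.
Proof.
move=> q0 sq; rewrite /normalized_odd_words /=.
have qR : (0 : R) < q%:R by rewrite ltr0n.
have := sqr_sqrtr (ltW qR); set r := Num.sqrt _ => r2.
have r0 : r != 0 by rewrite gt_eqF // sqrtr_gt0.
rewrite natrD !natrM natrB // -r2 !exprS.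
case: s sq => [|s] sq /=.
  by field; rewrite r0 expf_neq0.
rewrite !exprS; field; rewrite r0 expf_neq0 //.
Qed.

Lemma cvg_normalized_odd_words k s :
  normalized_odd_words k s q @[q --> \oo] --> ((limit_odd_words k s)%:R : R).
Proof.
elim: k s => [|k IH] s.
  rewrite /normalized_odd_words /=; apply: cvg_near_cst; apply: nearW => q.
  by rewrite expr0 divr1; case: s => [|s]; rewrite /= ?mul0r // mulr1.
have c : s%:R * normalized_odd_words k s.-1 q
  + (1 - s%:R / q%:R) * normalized_odd_words k s.+1 q @[q --> \oo] -->
  (s%:R * (limit_odd_words k s.-1)%:R
     + (1 - s%:R * 0) * (limit_odd_words k s.+1)%:R : R).
  apply: cvgD; first by apply: cvgM; [exact: cvg_cst|exact: IH].
  apply: cvgM; last exact: IH.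
  apply: cvgB; first exact: cvg_cst.
  apply: cvgM; first exact: cvg_cst.
  apply/gtr0_cvgV0; last exact: cvgr_idn.
  by near=> q; rewrite ltr0n; near: q; exact: nbhs_infty_gt.
rewrite /= natrD natrM; move: c; rewrite mulr0 subr0 mul1r.
apply: cvg_trans; apply: near_eq_cvg; near=> q.
by rewrite normalized_odd_wordsS //; near: q; 
   [exact: nbhs_infty_gt|exact: nbhs_infty_ge].
Unshelve. all: by end_near.
Qed.

End Limit.

(** * Convergence of the moments *)

Section MomentLimit.
Variable R : realType.
Implicit Type F : finFieldType.

Lemma sum_char_sumX F d k :
  \sum_(p <- monic_sqfrees F d) char_sum p ^+ k =
  \sum_(t <- words F k) \sum_(p <- monic_sqfrees F d) word_char t p.
Proof.
by rewrite exchange_big; apply: eq_bigr => p _; rewrite char_sumX.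
Qed.

Lemma char_sum_momentE k F d : char_sum_moment R k F d =
  (\sum_(p <- monic_sqfrees F d) char_sum p ^+ k)%:~R
    / (size (monic_sqfrees F d))%:R / Num.sqrt #|F|%:R ^+ k.
Proof.
rewrite /char_sum_moment card_monic_sqfree mulrC mulrAC; congr (_ / _).
rewrite rmorph_sum /= mulr_suml.
rewrite -[RHS](sum_monic_sqfree d (fun p =>
   ((char_sum p ^+ k)%:~R / Num.sqrt #|F|%:R ^+ k : R))).
by apply: eq_bigr => p _; rewrite /normalized_char_sum expr_div_n rmorphXn.
Qed.

Lemma size_monic_sqfreesS F n :
  (size (monic_sqfrees F n.+3) = #|F| * size (monic_sqfrees F n.+2))%N.
Proof.
apply/eqP; rewrite -(eqn_add2r (#|F| ^ n.+2)); apply/eqP.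
rewrite size_monic_sqfrees.
by rewrite (expnS _ n.+1) -mulnDr size_monic_sqfrees -expnS.
Qed.

Lemma size_monic_sqfrees_ge F n : (1 < #|F|)%N ->
  (#|F| ^ n.+2 <= 2 * size (monic_sqfrees F n.+2))%N.
Proof.
move=> q1; have := size_monic_sqfrees F n.
have : (2 * #|F| ^ n.+1 <= #|F| ^ n.+2)%N.
  by rewrite (expnS _ n.+1) leq_mul2r q1 orbT.
by lia.
Qed.

Lemma dist_sum_char_sumX F n k : odd #|F| ->
  `|(\sum_(p <- monic_sqfrees F n.+3) char_sum p ^+ k)%:~R
     - (size (monic_sqfrees F n.+3) * nb_odd_words #|F| k 0%N)%:R|
  <= (k * size (monic_sqfrees F n.+2) * nb_odd_words #|F| k 0%N)%:R
     + #|F|%:R ^+ (2 * k) * Num.sqrt (2 * #|F|%:R) ^+ n.+3 :> R.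
Proof.
move=> oq; set B := Num.sqrt _ ^+ _.
have B0 : 0 <= B by rewrite exprn_ge0 // sqrtr_ge0.
pose ev (t : seq F) := odd_letters t == finset.set0.
have nbE : nb_odd_words #|F| k 0%N = count ev (words F k).
  by rewrite -(cards0 F) -count_words_odd_letters.
rewrite sum_char_sumX nbE rmorph_sum /= -sum1_count.
rewrite !big_distrr /= !natr_sum [X in _ - X]big_mkcond -sumrB.
apply: le_trans (ler_norm_sum _ _ _) _.
(* The bound q^k B for one word with an odd letter is charged to each of the q^k words. *)
have -> : #|F|%:R ^+ (2 * k) * B =
    \sum_(t <- words F k) #|F|%:R ^+ k * B.
  rewrite big_const_seq count_predT iter_addr_0 size_words -[RHS]mulr_natl.
  by rewrite natrX mulrA -exprD addnn mul2n.
rewrite [X in _ <= X + _]big_mkcond -big_split /=.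
rewrite big_seq [leRHS]big_seq; apply: ler_sum => t /size_words_mem st.
case: ifPn => [/eqP et|ot].
  rewrite !muln1 -intr_natr -rmorphB -intr_norm.
  rewrite -[X in _ <= X + _]intr_natr -[X in X <= _]addr0.
  apply: lerD; last by rewrite mulr_ge0 // exprn_ge0.
  by rewrite ler_int -st; exact: sum_word_char_even.
rewrite subr0 add0r -intr_norm -st.
exact: sum_word_char_odd.
Qed.

(** The first error term is the chance k/q of a zero at a letter, the second comes from words with
    an odd letter. Beyond its threshold d does not enter, so q and d may grow independently. *)
Lemma dist_char_sum_moment k F d : odd #|F| -> (8 * k + 4 <= d)%N ->
  `|char_sum_moment R k F d - normalized_odd_words R k 0%N #|F| |
  <= (k%:R * normalized_odd_words R k 0%N #|F| + 2 ^+ (4 * k + 3)) / #|F|%:R.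
Proof.
move=> oq dk; have d3 : (3 <= d)%N by lia.
case: d dk d3 => [|[|[|n]]] // dk _.
have q1 : (1 < #|F|)%N by exact: card_finNzRing_gt1.
have q0R : (0 : R) < #|F|%:R by rewrite ltr0n ltnW.
set N := size (monic_sqfrees F n.+3).
have sN : N%:R = #|F|%:R * (size (monic_sqfrees F n.+2))%:R :> R.
  by rewrite -natrM -size_monic_sqfreesS.
have N2 : (#|F|%:R ^+ n.+3 <= 2 * N%:R :> R).
  by rewrite -natrX -natrM ler_nat size_monic_sqfrees_ge.
have N0 : (0 : R) < N%:R.
  have : (0 : R) < #|F|%:R ^+ n.+3 by rewrite exprn_gt0.
  lra.
set r : R := Num.sqrt #|F|%:R.
have r1 : 1 <= r.
  apply: (@le_trans _ _ (Num.sqrt 1)); first by rewrite sqrtr1.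
  by rewrite ler_wsqrtr // ler1n ltnW.
have rk : 0 < r ^+ k by rewrite exprn_gt0 //; lra.
rewrite char_sum_momentE -/N -/r /normalized_odd_words -/r expr0 mulr1.
have -> (x y : R) : x / N%:R / r ^+ k - y / r ^+ k =
    (x - N%:R * y) / N%:R / r ^+ k.
  by field; rewrite !gt_eqF.
rewrite normrM normfV (gtr0_norm rk) normrM normfV (gtr0_norm N0).
rewrite -natrM.
have := dist_sum_char_sumX n k oq; rewrite -/N.
move: (`| _ |) => a ha.
set W : R := (nb_odd_words _ _ _)%:R.
set rho : R := Num.sqrt (2 * #|F|%:R).
(* Of the d factors [rho], 2 (4 k + 2) are evaluated as (2 q)^(4 k + 2), saving q^(4 k + 2); the
   others are at most q because q >= 2. The saving exceeds the required q^(2 k + 1), and N >= q^d /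
   2 costs one more factor 2. *)
have tail : #|F|%:R ^+ (2 * k) * rho ^+ n.+3 / N%:R
    <= 2 ^+ (4 * k + 3) / #|F|%:R :> R.
  rewrite ler_pdivrMr // mulrAC ler_pdivlMr //.
  have q1R : (2 : R) <= #|F|%:R by rewrite ler_nat.
  have rho2 : rho ^+ 2 = 2 * #|F|%:R by rewrite sqr_sqrtr // mulr_ge0 // ltW.
  have rho0 : 0 <= rho by rewrite sqrtr_ge0.
  have rhoq : rho <= #|F|%:R.
    by rewrite -(ler_pXn2r (n := 2)) ?nnegrE ?(ltW q0R) // rho2 expr2 ler_pM2r.
  have [j ej] : exists j, n.+3 = (2 * (4 * k + 2) + j)%N.
    by exists (n.+3 - (2 * (4 * k + 2)))%N; rewrite subnKC // mulnDr mulnA.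
  apply: (@le_trans _ _ (2 ^+ (4 * k + 2) * #|F|%:R ^+ n.+3)); last first.
    rewrite (addnS (4 * k) 2) (exprS 2) -mulrA mulrCA.
    by rewrite ler_pM2l // exprn_gt0.
  apply: (@le_trans _ _ (#|F|%:R ^+ (2 * k) *
     ((2 * #|F|%:R) ^+ (4 * k + 2) * #|F|%:R ^+ j) * #|F|%:R)).
    rewrite ler_pM2r // ler_pM2l ?exprn_gt0 // ej exprD exprM rho2.
    by rewrite ler_wpM2l ?exprn_ge0 ?mulr_ge0 // ?lerXn2r ?nnegrE // ltW.
  rewrite exprMn -!mulrA mulrCA ler_pM2l ?exprn_gt0 //.
  rewrite -exprSr -!exprD; apply: ler_weXn2l; [lra|rewrite ej; clear; lia].
have -> : (k%:R * (W / r ^+ k) + 2 ^+ (4 * k + 3)) / #|F|%:R =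
   k%:R * W / #|F|%:R / r ^+ k + 2 ^+ (4 * k + 3) / #|F|%:R.
  by field; rewrite !gt_eqF.
apply: (@le_trans _ _
  (k%:R * W / #|F|%:R / r ^+ k
     + #|F|%:R ^+ (2 * k) * rho ^+ n.+3 / N%:R)); last first.
  by rewrite lerD2l.
apply: (@le_trans _ _
  ((k%:R * W / #|F|%:R + #|F|%:R ^+ (2 * k) * rho ^+ n.+3 / N%:R)
    / r ^+ k)).
  rewrite ler_pM2r ?invr_gt0 //.
  rewrite ler_pdivrMr // mulrDl divfK ?gt_eqF //.
  apply: (le_trans ha); rewrite lerD2r le_eqVlt; apply/orP; left; apply/eqP.
  by rewrite !natrM sN -/W; field; rewrite gt_eqF.
rewrite mulrDl lerD2l ler_piMr //; last by rewrite invf_le1 // exprn_ege1.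
by rewrite mulr_ge0 ?invr_ge0 ?ler0n // mulr_ge0 // exprn_ge0 // sqrtr_ge0.
Qed.

Theorem char_sum_moment_cvg k :
  joint_cvg (char_sum_moment R k) (nat_gauss_moment k)%:R.
Proof.
move=> e e0; have c := @cvg_normalized_odd_words R k 0%N.
rewrite limit_odd_wordsE ffactn0 mul1n subn0 in c.
set m : R := (nat_gauss_moment k)%:R in c *.
have m0 : 0 <= m by rewrite ler0n.
(* The minimum with 1 bounds the normalized word count by m + 1, so that the constant C below does
   not depend on the field. *)
have e2 : 0 < Num.min 1 (e / 2) by rewrite lt_min ltr01 divr_gt0.
move/cvgrPdist_lt : c => /(_ _ e2)[N0 _ HN0].
pose C : R := k%:R * (m + 1) + 2 ^+ (4 * k + 3).
have C0 : 0 <= C by rewrite addr_ge0 ?mulr_ge0 ?exprn_ge0 ?ler0n //; lra.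
pose N1 := (Num.bound (C / (e / 2))).+1.
exists (N0 + N1 + (8 * k + 4))%N => F d oq _ qN dN.
have /HN0 : (N0 <= #|F|)%N by lia.
rewrite /= lt_min => /andP[h1 h2].
have q0 : (0 : R) < #|F|%:R by rewrite ltr0n; lia.
have /(dist_char_sum_moment oq) h : (8 * k + 4 <= d)%N by lia.
rewrite -(subrK (normalized_odd_words R k 0%N #|F|) (char_sum_moment R k F d)).
rewrite -addrA; apply: le_lt_trans (ler_normD _ _) _.
rewrite [e]splitr; apply: ler_ltD; last by rewrite distrC.
apply: (le_trans h).
have a1 : normalized_odd_words R k 0%N #|F| <= m + 1.
  by move: h1; rewrite ltr_norml; lra.
apply: (@le_trans _ _ (C / #|F|%:R)).
  by rewrite ler_pM2r ?invr_gt0 // lerD2r ler_wpM2l.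
rewrite ler_pdivrMr // mulrC -ler_pdivrMr ?divr_gt0 //.
have hC : 0 <= C / (e / 2) by rewrite !divr_ge0 // ltW.
apply: le_trans (ltW (archi_boundP hC)) _; rewrite ler_nat.
by apply: leq_trans qN; rewrite /N1; clear; lia.
Qed.

End MomentLimit.

(** * Gaussian moments *)

Section GaussMoments.
Variable R : realType.
Local Notation mu := (@lebesgue_measure R).
Local Notation phi := (@normal_pdf R 0 1).

Lemma normal_pdf01E (x : R) :
  phi x = (Num.sqrt (2 * pi))^-1 * expR (- (x ^+ 2) / 2).
Proof.
rewrite normal_pdfE ?oner_neq0 // /normal_peak /normal_fun subr0 expr1n mul1r.
by rewrite -[pi *+ 2]mulr_natl.
Qed.

Lemma normX_le_expR k : exists2 C : R, 0 < C &
  forall x, `|x| ^+ k <= C * expR (x ^+ 2 / 4).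
Proof.
case: k => [|k].
  exists 1 => // x; rewrite expr0 mul1r -expR0 ler_expR.
  by rewrite divr_ge0 // sqr_ge0.
(* With this K, exp(x^2 / 4) is the (k + 1)-th power of exp(x^2 / K), and |x| <= K + x^2 <= K
   exp(x^2 / K) is enough. *)
pose K : R := 4 * k.+1%:R; have K4 : 4 <= K.
  by rewrite /K -[leLHS]mulr1 ler_pM2l // ler1n.
have K0 : 0 <= K by lra.
exists (K ^+ k.+1) => [|x]; first by rewrite exprn_gt0; lra.
have -> : x ^+ 2 / 4 = k.+1%:R * (x ^+ 2 / K).
  have : k.+1%:R != 0 :> R by rewrite pnatr_eq0.
  by rewrite /K; move: (k.+1%:R) => c c0; field.
rewrite expRM_natl -exprMn lerXn2r ?nnegrE ?mulr_ge0 ?expR_ge0 //.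
apply: (@le_trans _ _ (K * (1 + x ^+ 2 / K))); last first.
  by rewrite ler_pM2l ?expR_ge1Dx //; lra.
rewrite mulrDr mulr1 mulrCA divff ?mulr1; last by lra.
rewrite -[x ^+ 2]real_normK ?num_real //.
have := sqr_ge0 (`|x| - 1); have := sqr_ge0 `|x|; rewrite sqrrB. nra.
Qed.

(** Half of the exponent absorbs the power of x; the other half is, up to a constant, the normal
    density of variance 2. *)
Lemma normX_normal_pdf k : exists2 C : R, 0 < C &
  forall x, `|x ^+ k * phi x| <= C * normal_pdf 0 (Num.sqrt 2) x.
Proof.
have [C C0 hC] := normX_le_expR k.
have s2 : Num.sqrt 2 != 0 :> R by rewrite gt_eqF // sqrtr_gt0.
have p0 : (0 : R) < 2 * pi by rewrite mulr_gt0 // pi_gt0.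
pose a : R := (Num.sqrt (2 * pi))^-1.
have a0 : 0 < a by rewrite invr_gt0 sqrtr_gt0.
pose b : R := normal_peak (Num.sqrt 2).
have b0 : 0 < b by rewrite normal_peak_gt0.
exists (C * a / b) => [|x]; first by rewrite divr_gt0 // mulr_gt0.
rewrite normal_pdf01E normal_pdfE // -/a -/b /normal_fun subr0.
rewrite normrM normrX [`|a * _|]ger0_norm; last first.
  by rewrite mulr_ge0 ?expR_ge0 ?ltW.
have -> : C * a / b * (b * expR (- x ^+ 2 / (Num.sqrt 2 ^+ 2 *+ 2))) =
   C * expR (x ^+ 2 / 4) * (a * expR (- x ^+ 2 / 2)).
  rewrite sqr_sqrtr //.
  have -> : - x ^+ 2 / (2 *+ 2) = x ^+ 2 / 4 + - x ^+ 2 / 2 :> R by field.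
  by rewrite expRD; field; rewrite gt_eqF.
by rewrite ler_pM2r // mulr_gt0 // expR_gt0.
Qed.

Lemma is_derive_normal_pdf (x : R) : is_derive x 1 phi (- x * phi x).
Proof.
pose c : R := (Num.sqrt (2 * pi))^-1.
pose h (y : R) : R := - 2^-1 * y ^+ 2.
have phiE : phi = c \*: (expR \o h).
  apply/funext => y; rewrite normal_pdf01E; congr (_ * expR _).
  by rewrite /h; field.
have dh : is_derive x 1 h (- x).
  rewrite (_ : h = - 2^-1 \*: (id ^+ 2)) //.
  by apply: is_derive_eq; rewrite /= expr1 /GRing.scale /=; field.
rewrite phiE; apply: is_derive_eq.
by rewrite /= /GRing.scale /=; ring.
Qed.

Lemma continuous_exprM_normal_pdf k : continuous (fun x : R => x ^+ k * phi x).
Proof.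
move=> x; apply: cvgM; first exact: exprn_continuous.
by apply: continuous_normal_pdf; exact: oner_neq0.
Qed.

Lemma integrable_exprM_normal_pdf k :
  mu.-integrable setT (EFin \o (fun x => x ^+ k * phi x)).
Proof.
have [C C0 hC] := normX_normal_pdf k.
apply: (@le_integrable _ _ _ mu setT measurableT _
  (EFin \o (fun x => C * normal_pdf 0 (Num.sqrt 2) x))).
- apply/measurable_EFinP; apply: continuous_measurable_fun.
  exact: continuous_exprM_normal_pdf.
- move=> x _; rewrite /= lee_fin.
  by rewrite [X in _ <= X]ger0_norm ?hC // mulr_ge0 ?normal_pdf_ge0 ?ltW.
- exact: (integrableZl measurableT C (integrable_normal_pdf 0 (Num.sqrt 2))).
Qed.

Lemma normX_normal_pdf_bounded k : exists2 C : R, 0 < C &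
  forall x, `|x ^+ k * phi x| <= C.
Proof.
have [C C0 hC] := normX_normal_pdf k.
have s2 : Num.sqrt 2 != 0 :> R by rewrite gt_eqF // sqrtr_gt0.
exists (C * normal_peak (Num.sqrt 2)) => [|x].
  by rewrite mulr_gt0 ?normal_peak_gt0.
by apply: (le_trans (hC x)); rewrite ler_pM2l ?normal_pdf_ub.
Qed.

(** [H k] is the derivative of [G k], since phi' = - x phi; its integral over the line vanishes,
    which is the moment recursion. At k = 0 the factor k removes the term with [k.-1]. *)
Let G k (x : R) := x ^+ k * phi x.
Let H k (x : R) := k%:R * (x ^+ k.-1 * phi x) - x ^+ k.+1 * phi x.

Let is_derive_G k (x : R) : is_derive x 1 (G k) (H k x).
Proof.
rewrite (_ : G k = id ^+ k * phi); last first.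
  by apply/funext => y; rewrite /G mulrfctE exprfctE.
have dX : is_derive x 1 (id ^+ k : R -> R) (k%:R * x ^+ k.-1).
  by apply: is_derive_eq; rewrite -[_ *: _]/(_ * _) mulr1.
have [d1 d2] := is_deriveM dX (is_derive_normal_pdf x).
apply: DeriveDef; first exact: d1.
rewrite d2 /H /GRing.scale /= fctE /= exprS; ring.
Qed.

Let integrable_H k : mu.-integrable setT (EFin \o H k).
Proof.
have h1 := integrable_exprM_normal_pdf k.-1.
have h2 := integrable_exprM_normal_pdf k.+1.
exact: (integrableB measurableT (integrableZl measurableT k%:R h1) h2).
Qed.

Let continuous_H k : continuous (H k).
Proof.
move=> x; apply: cvgB; last exact: continuous_exprM_normal_pdf.
by apply: cvgM; [exact: cvg_cst|exact: continuous_exprM_normal_pdf].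
Qed.

Let integral_H_itv k (a : R) : 0 < a ->
  (\int[mu]_(x in `[(- a)%R, a]) (H k x)%:E = (G k a - G k (- a))%R%:E)%E.
Proof.
move=> a0; rewrite EFinB; apply: continuous_FTC2.
- by rewrite gtrN.
- exact/continuous_subspaceT/continuous_H.
- split; first by move=> x _; have [] := is_derive_G k x.
    by apply/cvg_at_right_filter; exact: continuous_exprM_normal_pdf.
  by apply/cvg_at_left_filter; exact: continuous_exprM_normal_pdf.
- by move=> x _; have dG := is_derive_G k x; rewrite derive1E derive_val.
Qed.

Let cvg_G0 k : G k n.+1%:R - G k (- n.+1%:R) @[n --> \oo] --> (0 : R).
Proof.
(* A bound for one power more gives decay like 1 / |x|. *)
have [C C0 hC] := normX_normal_pdf_bounded k.+1.
have hG (x : R) : 0 < `|x| -> `|G k x| <= C / `|x|.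
  by move=> x0; rewrite ler_pdivlMr // mulrC -normrM mulrA -exprS hC.
have hv n : `|G k n.+1%:R - G k (- n.+1%:R)| <= 2 * C * harmonic n.
  apply: (le_trans (ler_normB _ _)).
  have n0 : 0 < `|n.+1%:R : R| by rewrite normr_gt0.
  have := hG (n.+1%:R) n0; have := hG (- n.+1%:R); rewrite normrN => /(_ n0).
  rewrite /harmonic /= normr_nat => h1 h2.
  by rewrite -mulrA mulr_natl mulr2n lerD.
have c0 : 2 * C * harmonic n @[n --> \oo] --> (0 : R).
  rewrite -[X in _ --> X](mulr0 (2 * C)).
  by apply: cvgM; [exact: cvg_cst|exact: cvg_harmonic].
have cN : - (2 * C * harmonic n) @[n --> \oo] --> (0 : R).
  by rewrite -oppr0; apply: cvgN.
apply: (squeeze_cvgr _ cN c0).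
by apply: nearW => n; rewrite -ler_norml.
Qed.

Let integral_H k : (\int[mu]_x (H k x)%:E = 0)%E.
Proof.
pose f_ n := (EFin \o H k) \_ `[(- n.+1%:R), (n.+1%:R : R)]%classic.
have mH : measurable_fun setT (EFin \o H k).
  exact: measurable_int (integrable_H k).
have [] := @dominated_convergence _ _ _ mu setT measurableT f_
  (EFin \o H k) (abse \o (EFin \o H k)).
- move=> n; apply/(measurable_restrictT _ _).1 => //; exact: measurable_funTS.
- exact: mH.
- apply: aeW => x _; apply: cvg_near_cst; near=> n.
  rewrite /f_ patchE mem_set //= in_itv /= -ler_norml.
  apply: (le_trans (ltW (archi_boundP (normr_ge0 x)))).
  rewrite ler_nat; near: n; exists (Num.bound `|x|) => // m /= hm.
  exact: leqW.
- exact: integrable_abse (integrable_H k).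
- apply: aeW => x n _; rewrite /f_ patchE; case: ifP => //= _.
  by rewrite normr0 lee_fin.
move=> _ _; under eq_fun do rewrite -integral_mkcond integral_H_itv ?ltr0n //.
move=> c1; apply: (@cvg_unique _ (@ereal_hausdorff R) _ _ _ _ c1).
by apply: cvg_EFin; [exact: nearW|exact: cvg_G0].
Unshelve. all: by end_near.
Qed.

Lemma Rintegral_normal_pdf_recur k :
  \int[mu]_x (x ^+ k.+1 * phi x) = k%:R * \int[mu]_x (x ^+ k.-1 * phi x).
Proof.
apply/esym/eqP; rewrite -subr_eq0 -RintegralZl ?integrable_exprM_normal_pdf //.
rewrite -RintegralB ?integrable_exprM_normal_pdf //; last first.
  exact: (integrableZl measurableT _ (integrable_exprM_normal_pdf k.-1)).
by rewrite /Rintegral -[integral _ _ _]/(\int[mu]_x (H k x)%:E)%E integral_H.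
Qed.

Lemma Rintegral_exprM_normal_pdf k :
  \int[mu]_x (x ^+ k * phi x) = (nat_gauss_moment k)%:R.
Proof.
have [n] := ubnP k; elim: n k => // n IH [|[|k]] kn.
- under eq_Rintegral do rewrite expr0 mul1r.
  by rewrite /Rintegral integral_normal_pdf.
- by rewrite Rintegral_normal_pdf_recur mul0r.
by rewrite Rintegral_normal_pdf_recur IH -?natrM //; lia.
Qed.

Lemma gaussian_momentE k : gaussian_moment R k = (nat_gauss_moment k)%:R.
Proof.
rewrite -Rintegral_exprM_normal_pdf /gaussian_moment.
set c := _^-1; have c0 : c != 0.
  by rewrite invr_neq0 // gt_eqF // sqrtr_gt0 mulr_gt0 // pi_gt0.
rewrite -RintegralZl //; last first.
  rewrite (_ : _ \o _ = EFin \o (fun x => c^-1 * (x ^+ k * phi x))).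
    exact: (integrableZl measurableT _ (integrable_exprM_normal_pdf k)).
  by apply/funext => x; rewrite /= normal_pdf01E -/c mulrCA mulKf.
by apply: eq_Rintegral => x _; rewrite normal_pdf01E -/c mulrCA.
Qed.
End GaussMoments.

(** * Taylor approximation of cosines *)

Section Taylor.
Variable R : realType.
Implicit Types (g : nat -> R -> R) (b c x M : R).

(** The successive derivatives are given as data: [g i] stands for the i-th derivative of [g 0]. *)
Definition taylor_poly n g : {poly R} := \poly_(i < n) (g i 0 / i`!%:R).

Lemma deriv_taylor_poly n g :
  deriv (taylor_poly n.+1 g) = taylor_poly n (fun i => g i.+1).
Proof.
apply/polyP => i; rewrite coef_deriv !coef_poly ltnS.
case: ifP => _; last by rewrite mul0rn.
have i0 : i.+1%:R != 0 :> R by rewrite pnatr_eq0.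
have f0 : i`!%:R != 0 :> R by rewrite pnatr_eq0 -lt0n fact_gt0.
rewrite factS natrM -[_ / _ *+ _]mulr_natr.
by move: (i.+1%:R) (i`!%:R) i0 f0 => a b a0 b0; field; rewrite ?a0 ?b0.
Qed.

Lemma taylor_bound g M n :
  (forall i x, is_derive x 1 (g i) (g i.+1 x)) ->
  (forall x, `|g n x| <= M) ->
  forall x, 0 <= x -> `|g 0%N x - (taylor_poly n g).[x]| <= M * x ^+ n / n`!%:R.
Proof.
elim: n g => [|n IH] g dg gM x x0.
  rewrite /taylor_poly poly_def big_ord0 horner0 subr0 expr0 fact0.
  by rewrite mulr1 divr1.
have r0 : g 0%N 0 - (taylor_poly n.+1 g).[0] = 0.
  by rewrite horner_coef0 coef_poly /= fact0 divr1 subrr.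
move: x0; rewrite le_eqVlt => /predU1P[<-|x0].
  by rewrite r0 normr0 expr0n mulr0 mul0r.
pose q : {poly R} := (M / n.+1`!%:R) *: 'X^(n.+1).
have qE y : q.[y] = M * y ^+ n.+1 / n.+1`!%:R.
  by rewrite hornerZ hornerXn mulrAC.
have dqE y : (deriv q).[y] = M * y ^+ n / n`!%:R.
  have n0 : n.+1%:R != 0 :> R by rewrite pnatr_eq0.
  have f0 : n`!%:R != 0 :> R by rewrite pnatr_eq0 -lt0n fact_gt0.
  rewrite derivZ derivXn hornerZ hornerMn hornerXn /= factS natrM.
  rewrite -[y ^+ n *+ _]mulr_natr.
  by move: (n.+1%:R) (n`!%:R) n0 f0 => a b a0 b0; field; rewrite ?a0 ?b0.
(* The function h = q - s (g 0 - T) vanishes at 0, and its derivative is nonnegative on (0, x) by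
   the induction hypothesis for the shifted sequence; the mean value theorem gives h x >= 0. The
   signs s = 1 and s = -1 give the two sides. *)
have key (s : R) : `|s| = 1 ->
    s * (g 0%N x - (taylor_poly n.+1 g).[x]) <= q.[x].
  move=> s1.
  pose h y := (q + s *: taylor_poly n.+1 g).[y] - s * g 0%N y.
  pose dh y := (deriv (q + s *: taylor_poly n.+1 g)).[y] - s * g 1%N y.
  have dhP (y : R) : is_derive y 1 h (dh y).
    exact: (is_deriveB (is_derive_poly _ y) (is_deriveZ s (dg 0%N y))).
  have ch : {within `[0, x], continuous h}.
    apply: continuous_subspaceT => y; apply/differentiable_continuous.
    by apply/derivable1_diffP; have [] := dhP y.
  have [z] := MVT x0 (fun y _ => dhP y) ch.
  rewrite in_itv /= => /andP[z0 zx]; rewrite subr0 => hz.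
  have : 0 <= dh z * x.
    apply: mulr_ge0; last exact: ltW.
    rewrite /dh derivD [deriv (s *: _)]derivZ deriv_taylor_poly.
    rewrite hornerD hornerZ dqE.
    have := IH (fun i => g i.+1) (fun i => dg i.+1) gM z (ltW z0).
    set a := g 1%N z; set t := _.[z]; set B := _ / _ => hB.
    have : s * (a - t) <= B.
      by apply: le_trans (ler_norm _) _; rewrite normrM s1 mul1r.
    lra.
  have hE y : h y = q.[y] + s * (taylor_poly n.+1 g).[y] - s * g 0%N y.
    by rewrite /h hornerD [(s *: _).[_]]hornerZ.
  rewrite -hz !hE.
  have -> : q.[0] = 0 by rewrite qE expr0n mulr0 mul0r.
  have -> : (taylor_poly n.+1 g).[0] = g 0%N 0 by lra.
  lra.
rewrite -qE ler_norml; apply/andP; split.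
  by have := key (-1) (normrN1 _); lra.
by have := key 1 (normr1 _); lra.
Qed.

Definition cosine b c x := cos (b * x + c).

Definition cosine_poly b c n : {poly R} :=
  taylor_poly n (fun i x => b ^+ i * cosine b (c + (pi / 2) *+ i) x).

Lemma is_derive_cosine b c x :
  is_derive x 1 (cosine b c) (b * cosine b (c + pi / 2) x).
Proof.
have dh : is_derive x 1 (fun y => b * y + c) b.
  rewrite (_ : (fun _ => _) = b \*: id + cst c) //.
  by apply: is_derive_eq; rewrite addr0 -[_ *: _]/(_ * _) mulr1.
have := @is_derive1_comp R cos (fun y => b * y + c) x _ _ (is_derive_cos _) dh.
by rewrite /cosine addrA cosDpihalf mulrC.
Qed.

Lemma cosine_taylor_ge0 b c n x : 0 <= x ->
  `|cosine b c x - (cosine_poly b c n).[x]| <= `|b| ^+ n * x ^+ n / n`!%:R.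
Proof.
move=> x0; pose g i x := b ^+ i * cosine b (c + (pi / 2) *+ i) x.
have -> : cosine b c x = g 0%N x by rewrite /g expr0 mul1r addr0.
apply: taylor_bound x0 => [i y|y].
  have d := is_derive_cosine b (c + (pi / 2) *+ i) y.
  have -> : g i.+1 y = b ^+ i * (b * cosine b (c + (pi / 2) *+ i + pi / 2) y).
    by rewrite /g exprSr mulrA mulrSr addrA.
  rewrite (_ : g i = b ^+ i \*: cosine b (c + (pi / 2) *+ i)) //.
  exact: is_deriveZ.
rewrite /g normrM normrX ler_piMr ?exprn_ge0 // /cosine ler_norml.
by rewrite cos_geN1 cos_le1.
Qed.

(** Allows negative x to be treated by changing the signs of both b and x. *)
Lemma horner_cosine_polyN b c n x :
  (cosine_poly (- b) c n).[- x] = (cosine_poly b c n).[x].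
Proof.
rewrite !horner_poly; apply: eq_bigr => i _.
rewrite /cosine !mulr0 [(- b) ^+ i]exprNn [(- x) ^+ i]exprNn.
have := signrMK (R := R) i 1; rewrite mulr1; move: ((-1) ^+ i) => s s2.
by transitivity (s * s *
    (b ^+ i * cos (0 + (c + pi / 2 *+ i)) / i`!%:R * x ^+ i));
  [ring|rewrite s2 mul1r].
Qed.

(** The even order makes the error bound a polynomial in x, without absolute values, so that it is
    itself a test function. *)
Lemma cosine_taylor b c n x :
  `|cosine b c x - (cosine_poly b c n.*2).[x]|
    <= (b * x) ^+ n.*2 / n.*2`!%:R.
Proof.
have eX (y : R) : `|y| ^+ n.*2 = y ^+ n.*2.
  by rewrite -normrX ger0_norm // -mul2n exprM exprn_ge0 // sqr_ge0.
have [x0|x0] := leP 0 x.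
  by have := cosine_taylor_ge0 b c n.*2 x0; rewrite eX exprMn.
have nx0 : 0 <= - x by rewrite oppr_ge0 ltW.
have := cosine_taylor_ge0 (- b) c n.*2 nx0.
have -> : `|- b| ^+ n.*2 * (- x) ^+ n.*2 = (b * x) ^+ n.*2.
  by rewrite normrN eX -exprMn mulrN -mul2n !exprM sqrrN.
by rewrite horner_cosine_polyN /cosine mulrNN.
Qed.
End Taylor.

(** * Weierstrass approximation by Bernstein polynomials *)

Section Bernstein.
Variable R : realType.
Implicit Types (h : nat -> R) (u e M : R) (g : R -> R).

(* The Bernstein polynomial of degree n with nodal values h 0, ..., h n, by   *)
(* conditioning on the outcome of one of the n Bernoulli trials.              *)
Fixpoint bernstein n h : {poly R} :=
  if n is n'.+1 then
    'X * bernstein n' (fun k => h k.+1) + (1 - 'X) * bernstein n' h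
  else (h 0%N)%:P.

Lemma bernsteinS n h u : (bernstein n.+1 h).[u] =
  u * (bernstein n (fun k => h k.+1)).[u] + (1 - u) * (bernstein n h).[u].
Proof. by rewrite /= !hornerE. Qed.

Lemma bernstein_le n h1 h2 u : 0 <= u <= 1 -> (forall k, h1 k <= h2 k) ->
  (bernstein n h1).[u] <= (bernstein n h2).[u].
Proof.
move=> /andP[u0 u1]; elim: n h1 h2 => [|n IH] h1 h2 h12.
  by rewrite /= !hornerC.
by rewrite !bernsteinS lerD // ler_wpM2l ?subr_ge0 ?IH.
Qed.

(** For a binomial variable S with parameters n and u, the bracket is the second moment of S + c:
    squared mean plus variance. Conditioning on one trial shifts c by 1, hence the general c. *)
Lemma bernstein_quadratic n u a b c :
  (bernstein n (fun k => a + b * (k%:R + c) ^+ 2)).[u] =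
  a + b * ((n%:R * u + c) ^+ 2 + n%:R * (u * (1 - u))).
Proof.
elim: n c => [|n IH] c; first by rewrite /= hornerC !mul0r addr0.
have E k : a + b * (k.+1%:R + c) ^+ 2 = a + b * (k%:R + (1 + c)) ^+ 2.
  by rewrite -natr1 addrA.
rewrite bernsteinS; under eq_fun do rewrite E.
rewrite !IH -natr1; ring.
Qed.

(** Near u uniform continuity applies, and at distance at least d the bound 2 M is at most 2 M (y -
    u)^2 / d^2. A quadratic majorant is what [bernstein_quadratic] can evaluate. *)
Lemma bounded_continuous_modulus g M e : continuous g ->
  (forall x, `|g x| <= M) -> 0 < e ->
  exists2 K : R, 0 <= K & forall u y, 0 <= u <= 1 ->
    `|g y - g u| <= e + K * (y - u) ^+ 2.
Proof.
move=> cg gM e0.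
have M0 : 0 <= M by apply: le_trans (gM 0).
have [d d0 hd] : exists2 d : R, 0 < d & forall u y, 0 <= u <= 1 ->
    `|u - y| < d -> `|g y - g u| < e.
  have cpt : compact `[0%R, 1%R : R] by exact: segment_compact.
  have /compact_near_coveringP := cpt.
  pose P (d u : R) := forall y, `|u - y| < d -> `|g y - g u| < e.
  move=> /(_ R (0 : R)^'+ P _) [].
    move=> u _; have e2 : 0 < e / 2 by rewrite divr_gt0.
    have /cvgrPdist_lt/(_ _ e2)/nbhs_ballP[d /= d0 hd] := cg u.
    have d2 : 0 < d / 2 by rewrite divr_gt0.
    exists (ball u (d / 2), [set t | t < d / 2]).
      split; first exact: nbhsx_ballx.
      exact: nbhs_right_lt.
    move=> [v t] [/= uv td] y vy.
    have hv : `|g u - g v| < e / 2.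
      apply: hd; apply: le_ball uv.
      by rewrite ler_pdivrMr // ler_peMr ?ler1n // ltW.
    have hy : `|g u - g y| < e / 2.
      apply: hd; rewrite /ball /= in uv *.
      rewrite -(subrK v u) -addrA; apply: le_lt_trans (ler_normD _ _) _.
      by rewrite [d]splitr ltrD // (lt_trans vy).
    rewrite -(subrK (g u) (g y)) -addrA; apply: le_lt_trans (ler_normD _ _) _.
    by rewrite [e]splitr distrC ltrD.
  move=> d /= d0 hd; exists (d / 2); first by rewrite divr_gt0.
  move=> u y u01.
  have d2 : 0 < d / 2 by rewrite divr_gt0.
  apply: (hd (d / 2)) => //=.
  by rewrite sub0r normrN gtr0_norm // ltr_pdivrMr // ltr_pMr // ltr1n.
exists (2 * M / d ^+ 2) => [|u y u01].
  by rewrite divr_ge0 ?mulr_ge0 ?exprn_ge0 // ltW.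
have [lt|ge] := ltP `|u - y| d.
  apply: le_trans (ltW (hd u y u01 lt)) _; rewrite lerDl.
  by rewrite mulr_ge0 ?sqr_ge0 // divr_ge0 ?sqr_ge0 ?mulr_ge0.
apply: (@le_trans _ _ (2 * M)).
  by apply: le_trans (ler_normB _ _) _; rewrite mulr_natl mulr2n lerD ?gM.
rewrite -[leLHS]add0r lerD ?(ltW e0) // -mulrA -[leLHS]mulr1 ler_wpM2l //.
  by rewrite mulr_ge0.
rewrite ler_pdivlMl ?exprn_gt0 // mulr1.
by rewrite -[leRHS]real_normK ?num_real // distrC lerXn2r // nnegrE ltW.
Qed.

Lemma weierstrass g M e : continuous g -> (forall x, `|g x| <= M) -> 0 < e ->
  exists p : {poly R}, forall u, 0 <= u <= 1 -> `|p.[u] - g u| <= e.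
Proof.
move=> cg gM e0; have e2 : 0 < e / 2 by rewrite divr_gt0.
have [K K0 hK] := bounded_continuous_modulus cg gM e2.
pose n := (Num.bound (K / (e / 2))).+1.
have nK : K <= e / 2 * n%:R.
  rewrite mulrC -ler_pdivrMr //.
  apply: le_trans (ltW (archi_boundP _)) _; first by rewrite divr_ge0 // ltW.
  by rewrite ler_nat.
have n0 : (0 : R) < n%:R by rewrite ltr0n.
exists (bernstein n (fun k => g (k%:R / n%:R))) => u u01.
have hk k : `|g (k%:R / n%:R) - g u| <=
    e / 2 + K / n%:R ^+ 2 * (k%:R + - (n%:R * u)) ^+ 2.
  have -> : K / n%:R ^+ 2 * (k%:R - n%:R * u) ^+ 2 = K * (k%:R / n%:R - u) ^+ 2.
    by field; rewrite gt_eqF.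
  exact: hK.
have var : K / n%:R ^+ 2 *
    ((n%:R * u - n%:R * u) ^+ 2 + n%:R * (u * (1 - u))) <= e / 2.
  rewrite subrr expr0n add0r.
  have -> : K / n%:R ^+ 2 * (n%:R * (u * (1 - u))) = K / n%:R * (u * (1 - u)).
    by field; rewrite gt_eqF.
  apply: (@le_trans _ _ (K / n%:R)); last by rewrite ler_pdivrMr.
  rewrite ler_piMr ?divr_ge0 //.
  by case/andP: u01 => ? ?; nra.
rewrite ler_norml; apply/andP; split.
  have := @bernstein_le n (fun k => (g u - e / 2) +
    - (K / n%:R ^+ 2) * (k%:R + - (n%:R * u)) ^+ 2)
    (fun k => g (k%:R / n%:R)) u u01.
  rewrite bernstein_quadratic => h; rewrite lerBrDl.
  apply: le_trans (h _); last by move=> k; have := hk k; rewrite ler_norml; lra.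
  lra.
have := @bernstein_le n (fun k => g (k%:R / n%:R)) (fun k => (g u + e / 2) +
    (K / n%:R ^+ 2) * (k%:R + - (n%:R * u)) ^+ 2) u u01.
rewrite bernstein_quadratic => h; rewrite lerBlDl.
apply: le_trans (h _) _; last lra.
by move=> k; have := hk k; rewrite ler_norml; lra.
Qed.
End Bernstein.

(** * Test functions and weak convergence *)

Section JointConvergence.
Variable R : realType.
Implicit Types (u v w : finFieldType -> nat -> R) (a l m e : R).

Lemma joint_cvgD u v l m : joint_cvg u l -> joint_cvg v m ->
  joint_cvg (fun F d => u F d + v F d) (l + m).
Proof.
move=> ul vm e e0; have e2 : 0 < e / 2 by rewrite divr_gt0.
have [N1 h1] := ul _ e2; have [N2 h2] := vm _ e2.
exists (N1 + N2)%N => F d oq d3 Nq Nd.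
rewrite opprD addrACA; apply: le_lt_trans (ler_normD _ _) _.
rewrite [e]splitr ltrD ?h1 ?h2 //.
- exact: leq_trans (leq_addr _ _) Nq.
- exact: leq_trans (leq_addr _ _) Nd.
- exact: leq_trans (leq_addl _ _) Nq.
- exact: leq_trans (leq_addl _ _) Nd.
Qed.

Lemma joint_cvgZ a u l : joint_cvg u l ->
  joint_cvg (fun F d => a * u F d) (a * l).
Proof.
move=> ul e e0; have a1 : 0 < `|a| + 1 by rewrite ltr_wpDl.
have [N h] := ul _ (divr_gt0 e0 a1); exists N => F d oq d3 Nq Nd.
rewrite -mulrBr normrM; have := h F d oq d3 Nq Nd.
rewrite ltr_pdivlMr // mulrDr mulr1 mulrC => lt.
by apply: le_lt_trans lt; rewrite lerDl.
Qed.

(** The error [w] has to be small only in the limit, which admits unbounded polynomials as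
    errors. *)
Lemma joint_cvg_approx u l :
  (forall e, 0 < e -> exists v w m k,
     [/\ joint_cvg v m, joint_cvg w k, k <= e, `|m - l| <= e &
         forall F d, `|u F d - v F d| <= w F d]) -> joint_cvg u l.
Proof.
move=> app e e0; have e8 : 0 < e / 8 by rewrite divr_gt0.
have [v [w [m [k [vm wk ke ml uv]]]]] := app _ e8.
have [N1 h1] := vm _ e8; have [N2 h2] := wk _ e8.
exists (N1 + N2)%N => F d oq d3 Nq Nd.
have := h1 F d oq d3 (leq_trans (leq_addr _ _) Nq) (leq_trans (leq_addr _ _) Nd).
have := h2 F d oq d3 (leq_trans (leq_addl _ _) Nq) (leq_trans (leq_addl _ _) Nd).
move: (uv F d) ml; rewrite !ler_norml !ltr_norml.
move=> /andP[? ?] /andP[? ?] /andP[? ?] /andP[? ?]; apply/andP; split; lra.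
Qed.
End JointConvergence.

Section TestFunctions.
Variable R : realType.
Local Notation mu := (@lebesgue_measure R).
Local Notation phi := (@normal_pdf R 0 1).
Implicit Types (f g r : R -> R) (b c x e M : R) (p : {poly R}).

Definition family_mean f (F : finFieldType) (d : nat) : R :=
  #|monic_sqfree F d|%:R^-1 *
  \sum_(p in monic_sqfree F d) f (normalized_char_sum R p).

Definition gauss_mean f : R := \int[mu]_x (f x * phi x).

Record test_fun f : Prop := TestFun {
  test_fun_continuous : continuous f;
  test_fun_integrable : mu.-integrable setT (EFin \o (fun x => f x * phi x));
  test_fun_cvg : joint_cvg (family_mean f) (gauss_mean f) }.

Lemma family_meanD a b f g F d :
  family_mean (fun x => a * f x + b * g x) F d =
  a * family_mean f F d + b * family_mean g F d.
Proof.
rewrite /family_mean big_split /= -!mulr_sumr mulrDr.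
by congr (_ + _); exact: mulrCA.
Qed.

Lemma dist_family_mean f g r F d : (forall x, `|f x - g x| <= r x) ->
  `|family_mean f F d - family_mean g F d| <= family_mean r F d.
Proof.
move=> fgr; rewrite /family_mean -mulrBr normrM ger0_norm ?invr_ge0 //.
rewrite ler_wpM2l ?invr_ge0 // -sumrB; apply: le_trans (ler_norm_sum _ _ _) _.
exact: ler_sum.
Qed.

Lemma integrable_lin a b f g :
  mu.-integrable setT (EFin \o (fun x => f x * phi x)) ->
  mu.-integrable setT (EFin \o (fun x => g x * phi x)) ->
  mu.-integrable setT (EFin \o (fun x => (a * f x + b * g x) * phi x)).
Proof.
move=> fi gi.
rewrite (_ : _ \o _ = EFin \o (fun x => a * (f x * phi x) + b * (g x * phi x))).
  exact: (integrableD measurableT (integrableZl measurableT a fi)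
     (integrableZl measurableT b gi)).
by apply/funext => x /=; rewrite mulrDl !mulrA.
Qed.

Lemma gauss_meanD a b f g :
  mu.-integrable setT (EFin \o (fun x => f x * phi x)) ->
  mu.-integrable setT (EFin \o (fun x => g x * phi x)) ->
  gauss_mean (fun x => a * f x + b * g x) = a * gauss_mean f + b * gauss_mean g.
Proof.
move=> fi gi; rewrite /gauss_mean -!RintegralZl // -RintegralD //.
- by apply: eq_Rintegral => x _; rewrite mulrDl !mulrA.
- exact: (integrableZl measurableT a fi).
- exact: (integrableZl measurableT b gi).
Qed.

Lemma test_fun_lin a b f g : test_fun f -> test_fun g ->
  test_fun (fun x => a * f x + b * g x).
Proof.
move=> [cf fi fc] [cg gi gc]; split.
- move=> x; apply: cvgD; first by apply: cvgM; [exact: cvg_cst|exact: cf].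
  by apply: cvgM; [exact: cvg_cst|exact: cg].
- exact: integrable_lin.
rewrite gauss_meanD //.
rewrite (_ : family_mean _ =
    fun F d => a * family_mean f F d + b * family_mean g F d).
  by apply: joint_cvgD; exact: joint_cvgZ.
by apply/funext => F; apply/funext => d; rewrite family_meanD.
Qed.

Lemma test_fun_exprn n : test_fun (fun x => x ^+ n).
Proof.
split; [exact: exprn_continuous|exact: integrable_exprM_normal_pdf|].
rewrite /gauss_mean Rintegral_exprM_normal_pdf; exact: char_sum_moment_cvg.
Qed.

Lemma gauss_mean_exprn n :
  gauss_mean (fun x => x ^+ n) = (nat_gauss_moment n)%:R.
Proof. exact: Rintegral_exprM_normal_pdf. Qed.

Lemma test_fun_sum n (a : nat -> R) (f : nat -> R -> R) :
  (forall i, test_fun (f i)) -> test_fun (fun x => \sum_(i < n) a i * f i x).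
Proof.
move=> tf; elim: n => [|n IH].
  have := test_fun_lin 0 0 (test_fun_exprn 0) (test_fun_exprn 0).
  by congr test_fun; apply/funext => x; rewrite big_ord0 !mul0r addr0.
have := test_fun_lin 1 (a n) IH (tf n).
by congr test_fun; apply/funext => x; rewrite big_ord_recr mul1r.
Qed.

Lemma test_fun_poly p : test_fun (horner p).
Proof.
have := test_fun_sum (size p) (nth 0 p) test_fun_exprn.
by congr test_fun; apply/funext => x; rewrite horner_coef.
Qed.

(** The bound |f| <= |g| + r gives integrability, and the Gaussian means of f and g differ by at
    most that of r. *)
Lemma test_fun_approx f : continuous f ->
  (forall e, 0 < e -> exists g r, [/\ test_fun g, test_fun r,
     gauss_mean r <= e & forall x, `|f x - g x| <= r x]) -> test_fun f.
Proof.
move=> cf app.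
have fi : mu.-integrable setT (EFin \o (fun x => f x * phi x)).
  have [g [r [[cg gi _] [cr ri _] _ fgr]]] := app 1 ltr01.
  apply: (@le_integrable _ _ _ mu setT measurableT _
    (EFin \o (fun x => `|g x * phi x| + r x * phi x))).
  - apply/measurable_EFinP; apply: continuous_measurable_fun => x.
    by apply: cvgM; [exact: cf|apply: continuous_normal_pdf; exact: oner_neq0].
  - move=> x _; rewrite /= lee_fin [leRHS]ger0_norm; last first.
      rewrite addr_ge0 // mulr_ge0 ?normal_pdf_ge0 //.
      exact: le_trans (fgr x).
    rewrite !normrM [`|phi x|]ger0_norm ?normal_pdf_ge0 // -mulrDl.
    rewrite ler_wpM2r ?normal_pdf_ge0 // -[f x](subrK (g x)) addrC.
    by apply: le_trans (ler_normD _ _) _; rewrite lerD2l.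
  - exact: (integrableD measurableT (integrable_abse gi) ri).
split => //; apply: joint_cvg_approx => e e0.
have [g [r [[cg gi gc] [cr ri rc] re fgr]]] := app e e0.
exists (family_mean g), (family_mean r), (gauss_mean g), (gauss_mean r).
split => //; last by move=> F d; exact: dist_family_mean.
apply: le_trans re; rewrite distrC /gauss_mean -RintegralB //.
apply: (le_trans (le_normr_Rintegral _ _)) => //.
  exact: (integrableB measurableT fi gi).
apply: le_Rintegral => //.
  exact: (integrable_abse (integrableB measurableT fi gi)).
move=> x _; rewrite -mulrBl normrM [`|phi x|]ger0_norm ?normal_pdf_ge0 //.
by rewrite ler_wpM2r ?normal_pdf_ge0.
Qed.

Lemma nat_gauss_moment_even n :
  (nat_gauss_moment n.*2 * (2 ^ n * n`!) = n.*2`!)%N.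
Proof.
elim: n => // n IH; rewrite doubleS nat_gauss_momentSS !factS -IH expnS.
rewrite -[n.*2.+2]/(n.+1.*2) -mul2n; move: (nat_gauss_moment _) (2 ^ n)%N n`!%N.
by move=> a b c; lia.
Qed.

Lemma continuous_cosine b c : continuous (cosine b c).
Proof.
move=> x; apply/differentiable_continuous/derivable1_diffP.
by have [] := is_derive_cosine b c x.
Qed.

(** By [nat_gauss_moment_even], the Taylor error b^(2 n) x^(2 n) / (2 n)! has Gaussian mean (b^2 /
    2)^n / n!, a term of an exponential series. *)
Lemma test_fun_cosine b c : test_fun (cosine b c).
Proof.
apply: test_fun_approx => [|e e0]; first exact: continuous_cosine.
have /cvgrPdist_lt/(_ _ e0)[n _ hn] := cvg_exp_coeff (b ^+ 2 / 2).
exists (horner (cosine_poly b c n.*2)).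
exists (fun x => b ^+ n.*2 / n.*2`!%:R * x ^+ n.*2 + 0 * x ^+ n.*2).
split; first exact: test_fun_poly.
- by apply: test_fun_lin; exact: test_fun_exprn.
- rewrite gauss_meanD; try exact: integrable_exprM_normal_pdf.
  rewrite gauss_mean_exprn mul0r addr0 -nat_gauss_moment_even !natrM natrX.
  have := hn n (leqnn n); rewrite /= sub0r normrN /exp_coeff /=.
  have n0 : (nat_gauss_moment n.*2)%:R != 0 :> R.
    rewrite pnatr_eq0 -lt0n; have := fact_gt0 n.*2.
    by rewrite -nat_gauss_moment_even muln_gt0 => /andP[].
  have f0 : n`!%:R != 0 :> R by rewrite pnatr_eq0 -lt0n fact_gt0.
  have p0 : (2 : R) ^+ n != 0 by rewrite expf_neq0 // pnatr_eq0.
  rewrite expr_div_n -exprM mul2n => /ltW h.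
  apply: le_trans h; apply: le_trans (ler_norm _).
  rewrite le_eqVlt; apply/orP; left; apply/eqP.
  move: (_%:R) (_ ^+ n) (_%:R) (b ^+ _) n0 p0 f0 => m t s z m0 t0 s0.
  by field; rewrite m0 t0 s0.
move=> x; rewrite mul0r addr0; apply: (le_trans (cosine_taylor b c n x)).
by rewrite exprMn mulrAC.
Qed.
End TestFunctions.

(** * From cosines to bounded continuous functions *)

Section BoundedTestFunctions.
Variable R : realType.
Implicit Types (f g : R -> R) (b c x e M xi : R) (p : {poly R}).

(** Each sine factor is a shifted cosine, and the product formula turns it into two cosines with new
    frequency and phase; hence the induction over all b and c. *)
Lemma test_fun_cosine_sinX b c xi n :
  test_fun (fun x => sin (xi * x) ^+ n * cosine b c x).
Proof.
elim: n b c => [|n IH] b c.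
  have := test_fun_cosine b c.
  by congr test_fun; apply/funext => x; rewrite expr0 mul1r.
have := test_fun_lin 2^-1 2^-1
  (IH (b + xi) (c - pi / 2)) (IH (b - xi) (c + pi / 2)).
congr test_fun; apply/funext => x.
have -> : sin (xi * x) = cos (xi * x - pi / 2) by rewrite cosBpihalf.
rewrite /cosine.
have -> : (b + xi) * x + (c - pi / 2) = (b * x + c) + (xi * x - pi / 2) by ring.
have -> : (b - xi) * x + (c + pi / 2) = (b * x + c) - (xi * x - pi / 2) by ring.
by rewrite (cosB (b * x + c)) (cosD (b * x + c)) exprS; field.
Qed.

Lemma test_fun_poly_sin p xi : test_fun (fun x => p.[sin (xi * x)]).
Proof.
have := test_fun_sum (size p) (nth 0 p) (test_fun_cosine_sinX 0 0 xi).
congr test_fun; apply/funext => x; rewrite horner_coef.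
by apply: eq_bigr => i _; rewrite /cosine mul0r addr0 cos0 mulr1.
Qed.

Lemma continuous_asin_clamp (s : R) : 0 <= s < 1 ->
  continuous (fun u : R => asin (Num.max (- s) (Num.min s u))).
Proof.
move=> /andP[s0 s1] u; apply: (@continuous_comp _ _ _
  (fun u : R => Num.max (- s) (Num.min s u)) asin).
  apply: continuous_max; first exact: cvg_cst.
  by apply: continuous_min; [exact: cvg_cst|exact: cvg_id].
apply: continuous_asin; apply/andP; split.
  by rewrite lt_max ltrN2 s1.
rewrite gt_max gt_min s1 /= andbT; lra.
Qed.

(** Where |xi x| <= 1/2, x is recovered from sin(xi x) by the arcsine, so f is there a continuous
    function of sin(xi x) and Weierstrass applies. Elsewhere 4 (xi x)^2 >= 1, and the quadratic term
    covers the trivial bound 2 M. *)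
Lemma bounded_continuous_sin_approx f M e xi : continuous f ->
  (forall x, `|f x| <= M) -> 0 < e -> 0 < xi ->
  exists p, forall x, `|f x - p.[sin (xi * x)]| <= e + 8 * M * xi ^+ 2 * x ^+ 2.
Proof.
move=> cf fM e0 xi0; have M0 : 0 <= M by apply: le_trans (fM 0).
pose s : R := sin 2^-1.
have pi2 := pi_ge2 R.
have in_half (y : R) : `|y| <= 2^-1 -> y \in `[- (pi / 2), pi / 2]%R.
  by rewrite in_itv /= ler_norml; lra.
have half_in : (2^-1 : R) \in `[- (pi / 2), pi / 2]%R by rewrite in_itv /=; lra.
have pih_in : (pi / 2 : R) \in `[- (pi / 2), pi / 2]%R.
  by rewrite in_itv /=; lra.
have s1 : s < 1 by rewrite -(sin_pihalf R) /s ltr_sin //; lra.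
have s0 : 0 <= s by apply: sin_ge0_pi; lra.
(* The affine map v = (1 + sin) / 2 moves [-1, 1] to [0, 1]; the clamp at s = sin(1/2) < 1 keeps the
   arcsine continuous and is inactive for |xi x| <= 1/2. *)
pose g v := f (asin (Num.max (- s) (Num.min s (2 * v - 1))) / xi).
have cg : continuous g.
  move=> v; apply: (@continuous_comp _ _ _
    (fun v : R => asin (Num.max (- s) (Num.min s (2 * v - 1))) / xi) f);
    last exact: cf.
  apply: cvgM; last exact: cvg_cst.
  apply: (@continuous_comp _ _ _ (fun v : R => 2 * v - 1)
    (fun u : R => asin (Num.max (- s) (Num.min s u)))).
    apply: cvgB; last exact: cvg_cst.
    by apply: cvgM; [exact: cvg_cst|exact: cvg_id].
  by apply: continuous_asin_clamp; rewrite s0 s1.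
have [p hp] := @weierstrass R g M e cg (fun v => fM _) e0.
exists (p \Po ((2^-1)%:P * (1 + 'X))) => x.
pose v := 2^-1 * (1 + sin (xi * x)).
have vE : ((2^-1)%:P * (1 + 'X)).[sin (xi * x)] = v by rewrite !hornerE.
rewrite horner_comp vE.
have v01 : 0 <= v <= 1.
  by have := sin_geN1 (xi * x); have := sin_le1 (xi * x); rewrite /v; lra.
have [small|big] := leP `|xi * x| 2^-1.
  have -> : f x = g v.
    rewrite /g; have -> : 2 * v - 1 = sin (xi * x) by rewrite /v; field.
    have xin := in_half _ small.
    have := small; rewrite ler_norml => /andP[x1 x2].
    have nhalf_in : (- 2^-1 : R) \in `[- (pi / 2), pi / 2]%R.
      by rewrite in_itv /=; lra.
    have ss : sin (xi * x) <= s by rewrite /s leNgt ltr_sin // -leNgt.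
    have sN : - s <= sin (xi * x) by rewrite /s -sinN leNgt ltr_sin // -leNgt.
    by rewrite (min_idPr ss) (max_idPr sN) sinK // mulrAC divff ?mul1r // gt_eqF.
  rewrite distrC; apply: le_trans (hp v v01) _.
  by rewrite lerDl mulr_ge0 ?sqr_ge0 // mulr_ge0 ?sqr_ge0 // mulr_ge0.
apply: (@le_trans _ _ (e + 2 * M)).
  have := hp v v01; have := fM x.
  have : `|g v| <= M by exact: fM.
  rewrite !ler_norml; lra.
rewrite lerD2l -[leLHS]mulr1.
have -> : 8 * M * xi ^+ 2 * x ^+ 2 = (2 * M) * (4 * (xi * x) ^+ 2) by ring.
rewrite ler_wpM2l ?mulr_ge0 //.
rewrite -[(xi * x) ^+ 2]real_normK ?num_real //; nra.
Qed.

Lemma test_fun_bounded f M : continuous f -> (forall x, `|f x| <= M) ->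
  test_fun f.
Proof.
move=> cf fM; apply: test_fun_approx => // e e0.
have M0 : 0 <= M by apply: le_trans (fM 0).
(* The error has Gaussian mean e / 2 + 8 M xi^2, as the second moment is 1; this xi is at most 1 and
   satisfies 8 M xi <= e / 2. *)
pose xi := (1 + 16 * M / e)^-1.
have q0 : 0 <= 16 * M / e by rewrite divr_ge0 ?mulr_ge0 // ltW.
have xi0 : 0 < xi by rewrite invr_gt0; lra.
have xi1 : xi <= 1 by rewrite invf_le1 //; lra.
have e2 : 0 < e / 2 by rewrite divr_gt0.
have [p hp] := bounded_continuous_sin_approx cf fM e2 xi0.
exists (fun x => p.[sin (xi * x)]).
exists (fun x => e / 2 * x ^+ 0 + 8 * M * xi ^+ 2 * x ^+ 2).
split; first exact: test_fun_poly_sin.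
- by apply: test_fun_lin; exact: test_fun_exprn.
- rewrite gauss_meanD; try exact: integrable_exprM_normal_pdf.
  rewrite !gauss_mean_exprn /= !mulr1 [e in leRHS]splitr lerD2l.
  have h : 8 * M * xi <= e / 2.
    rewrite /xi ler_pdivrMr; last by lra.
    have -> : e / 2 * (1 + 16 * M / e) = e / 2 + 8 * M by field; rewrite gt_eqF.
    lra.
  by apply: le_trans h; rewrite expr2 mulrA ler_piMr ?mulr_ge0 ?(ltW xi0).
by move=> x; rewrite expr0 mulr1.
Qed.
End BoundedTestFunctions.

(** * Integrals against the normal and uniform laws *)

Section Laws.
Variable R : realType.
Local Notation mu := (@lebesgue_measure R).

(** The Radon-Nikodym derivative of the normal law and its density have the same integral over every
    measurable set, hence agree almost everywhere. *)
Lemma Rintegral_normal_prob (f : R -> R) M : continuous f ->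
  (forall x, `|f x| <= M) ->
  \int[normal_prob 0 1]_x f x = gauss_mean f.
Proof.
move=> cf fM; have mf := continuous_measurable_fun cf.
pose nu : {finite_measure set (measurableTypeR R) -> \bar R} := normal_prob 0 1.
have dom := @normal_prob_dominates R 0 1.
have nu1 : nu setT = 1%E by exact: (@probability_setT _ _ _ (normal_prob 0 1)).
have fi : nu.-integrable setT (EFin \o f).
  apply: measurable_bounded_integrable => //.
    exact: (eq_ind_r (fun z => z < +oo)%E (ltry 1) nu1).
  exists M; split; first exact: num_real.
  by move=> N MN x _ /=; apply: le_trans (fM x) (ltW MN).
have mphi : measurable_fun setT (EFin \o @normal_pdf R 0 1).
  by apply/measurable_EFinP; exact: measurable_normal_pdf.
have mEf : measurable_fun setT (EFin \o f) by exact/measurable_EFinP.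
rewrite /gauss_mean /Rintegral; congr fine.
transitivity (\int[nu]_x (f x)%:E)%E; first by [].
rewrite -(@Radon_Nikodym_change_of_variables _ _ _ nu mu dom _ setT) //.
have iRN := @Radon_Nikodym_integrable _ _ _ (charge_of_finite_measure nu) mu dom.
apply: ae_eq_integral => //.
- apply: emeasurable_funM => //; exact: measurable_int iRN.
- exact: (emeasurable_funM mEf mphi).
- apply: (@ae_eqe_mul2l _ _ _ mu setT _ (EFin \o @normal_pdf R 0 1) (EFin \o f)).
  apply: integral_ae_eq => // E _ mE.
  by rewrite -Radon_Nikodym_integral.
Qed.

Lemma ge0_integral_uniform_law (T : finType) (A : {set T}) (X : T -> R)
    (f : R -> \bar R) : measurable_fun setT f -> (forall x, 0 <= f x)%E ->
  (\int[uniform_law A X]_x f x = #|A|%:R^-1%:E * \sum_(t in A) f (X t))%E.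
Proof.
move=> mf f0.
pose y (i : nat) : R := nth 0 (map X (enum A)) i.
pose atom (i : nat) : {measure set (measurableTypeR R) -> \bar R} :=
  @dirac _ (measurableTypeR R) (y i) R.
have sumE (g : R -> \bar R) :
    (\sum_(i < #|A|) g (y i) = \sum_(t in A) g (X t))%E.
  rewrite -[RHS]big_enum -(big_map X xpredT g) (big_nth 0%R) big_mkord.
  by rewrite size_map -cardE.
have c0 : (0 : R) <= #|A|%:R^-1 by rewrite invr_ge0.
pose m : {measure set (measurableTypeR R) -> \bar R} :=
  mscale (NngNum c0) (msum atom #|A|).
transitivity (\int[m]_x f x)%E.
  apply: eq_measure_integral => B mB _.
  rewrite /m /= /mscale /= /msum (sumE (fun z => \d_z B)) sumEFin.
  rewrite /uniform_law mulrC EFinM; congr (_ * EFin _)%E.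
  rewrite -sum1_card natr_sum; rewrite [LHS]big_mkcond [RHS]big_mkcond.
  apply: eq_bigr => t _; rewrite !inE indicE.
  by case: (t \in A) => //=; case: (X t \in B).
rewrite /m ge0_integral_mscale // ge0_integral_measure_sum //.
congr (_ * _)%E; rewrite -sumE; apply: eq_bigr => i _.
by rewrite integral_dirac // diracT mul1e.
Qed.

Lemma Rintegral_uniform_law (T : finType) (A : {set T}) (X : T -> R)
    (f : R -> R) : measurable_fun setT f ->
  \int[uniform_law A X]_x f x = #|A|%:R^-1 * \sum_(t in A) f (X t).
Proof.
move=> mf; have mEf : measurable_fun setT (EFin \o f) by exact/measurable_EFinP.
rewrite /Rintegral integralE.
rewrite (ge0_integral_uniform_law A X (measurable_funepos mEf)) //.
rewrite (ge0_integral_uniform_law A X (measurable_funeneg mEf)) //.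
have -> : (\sum_(t in A) (EFin \o f)^\+ (X t) =
    (\sum_(t in A) Num.max (f (X t)) 0)%:E)%E.
  by rewrite -sumEFin; apply: eq_bigr => t _; rewrite funeposE EFin_max.
have -> : (\sum_(t in A) (EFin \o f)^\- (X t) =
    (\sum_(t in A) Num.max (- f (X t)) 0)%:E)%E.
  by rewrite -sumEFin; apply: eq_bigr => t _; rewrite funenegE EFin_max.
rewrite -!EFinM -EFinB /= -mulrBr -sumrB; congr (_ * _).
apply: eq_bigr => t _; have [h|h] := leP 0 (f (X t)).
  by rewrite max_r ?subr0 // oppr_le0.
by rewrite max_l ?oppr_ge0 ?ltW // add0r opprK.
Qed.
End Laws.

Theorem theorem2 (R : realType) :
  (forall k : nat, (1 <= k)%N ->
     joint_cvg (char_sum_moment R k) (gaussian_moment R k)) /\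
  joint_weak_cvg (char_sum_law R) (normal_prob 0%R 1%R).
Proof.
split=> [k _|f cf [M [_ fM]]].
  rewrite gaussian_momentE; exact: char_sum_moment_cvg.
(* Boundedness supplies every bound strictly above M, hence M + 1. *)
have fM1 x : `|f x| <= M + 1 by apply: fM; rewrite ?ltrDl.
have [_ _ cvg_f] := test_fun_bounded cf fM1.
rewrite (Rintegral_normal_prob cf fM1).
rewrite (_ : (fun F d => _) = family_mean f) //.
apply/funext => F; apply/funext => d.
by rewrite Rintegral_uniform_law //; exact: continuous_measurable_fun.
Qed.
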